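(* There exists a compact polynomially convex set $X \subset \mathbb{C}^2$ such that $P(X) \neq C(X)$ but every point of $X$ is a peak point for $P(X)$.
   Context: For a compact set $X \subset \mathbb{C}^n$, $C(X)$ is the algebra of continuous complex-valued functions on $X$ with the supremum norm, and $P(X) \subset C(X)$ is the uniform closure on $X$ of the polynomials in the complex coordinate functions $z_1, \ldots, z_n$. The polynomially convex hull of $X$ is $\widehat{X} = \{z \in \mathbb{C}^n : |p(z)| \le \max_{x \in X} |p(x)| \text{ for all polynomials } p\}$, and $X$ is polynomially convex if $\widehat{X} = X$. If $A$ is a uniform algebra on a compact space $X$ (a closed subalgebra of $C(X)$ containing the constants and separating the points of $X$), a point $x \in X$ is a peak point for $A$ if there exists $f \in A$ with $f(x) = 1$ and $|f(y)| < 1$ for all $y \in X \setminus \{x\}$. *)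

(* Defs.v *)
From HB Require Import structures.
From mathcomp Require Import all_boot all_order all_algebra.
From mathcomp Require Import complex.
From mathcomp Require Import boolp classical_sets functions reals topology normedtype.
(* not imported: its notations clash with those of mathcomp-analysis *)
From mathcomp Require mpoly.
Set Implicit Arguments.
Unset Strict Implicit.
Unset Printing Implicit Defensive.
Import Order.TTheory GRing.Theory Num.Theory.
Import numFieldNormedType.Exports.
Local Open Scope classical_set_scope.
Local Open Scope ring_scope.
Local Open Scope complex_scope.

(* R[i] itself carries no canonical topology; seen as a numClosedFieldType it
   inherits the one given by its norm. *)
Definition cplx (R : realType) : numClosedFieldType := R[i].

Definition peval (R : realType) (n : nat) (p : mpoly.mpoly n (cplx R))
    (z : 'rV[cplx R]_n) : cplx R :=
  mpoly.meval (z ord0) p.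

(* The norm of cplx R takes its values in cplx R, whose order is partial, so
   the supremum is taken in R. *)
Definition sup_norm (R : realType) (n : nat) (X : set 'rV[cplx R]_n)
    (f : 'rV[cplx R]_n -> cplx R) : R :=
  sup [set complex.Re `|f x| | x in X].

(* When X is compact and nonempty the supremum is a maximum; when X is empty it
   is 0, and the constant polynomial 1 shows that the hull is empty. *)
Definition poly_hull (R : realType) (n : nat) (X : set 'rV[cplx R]_n) :
    set 'rV[cplx R]_n :=
  [set z | forall p : mpoly.mpoly n (cplx R),
    `|peval p z| <= (sup_norm X (peval p))%:C].

Definition poly_convex (R : realType) (n : nat)
    (X : set 'rV[cplx R]_n) : Prop :=
  poly_hull X = X.

(* A function on X is represented by any function on the whole space extending
   it. The sets CX X and PX X below only depend on the values on X, so they are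
   equal exactly when the corresponding sets of functions on X are. *)
Definition CX (R : realType) (n : nat) (X : set 'rV[cplx R]_n) :
    set ('rV[cplx R]_n -> cplx R) :=
  [set f | {within X, continuous f}].

Definition PX (R : realType) (n : nat) (X : set 'rV[cplx R]_n) :
    set ('rV[cplx R]_n -> cplx R) :=
  closure (range (@peval R n) : set {uniform` X -> cplx R}).

Definition peak_point (R : realType) (n : nat) (X : set 'rV[cplx R]_n)
    (A : set ('rV[cplx R]_n -> cplx R)) (x : 'rV[cplx R]_n) : Prop :=
  X x /\ exists f, [/\ A f, f x = 1 &
                       forall y, X y -> y <> x -> `|f y| < 1].

(* Main.v *)
Require Import Defs.
From mathcomp Require Import all_boot all_order all_algebra.
From mathcomp Require Import boolp classical_sets reals topology normedtype.
From mathcomp Require Import complex functions ring lra zify.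
From mathcomp Require mpoly.

(** A plane compact set K with R(K) <> C(K) always has points that are not peak
    points for R(K).  The natural localizing functions are
    f = 1 / (1 + ((z - a) / r)^n), close to 1 for |z - a| < r and close to 0
    outside: they fail because they are large near their poles, unless large
    neighbourhoods of the poles are removed from K.  Adjoining roots, an idea of
    Cole, cures this.  An m-th root u of f satisfies |u| <= 2 off holes around the
    n poles whose total radius is of order 2^-m, however large n is; and if n is
    much larger than m, then u is still tiny for |z - a| >= 2 r.

    Let the discs (a_k, r_k) contain arbitrarily small neighbourhoods of every
    point, put g_k(z) = 1 + ((z - a_k) / r_k)^(n_k), and consider all
    (z, u_0, u_1, ...) with |z| <= 2, g_k(z) u_k^(m_k) = 1 and |u_k| <= 2.  This
    set is defined by polynomial equations and inequalities, so it is polynomially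
    convex.  It is brought into C^2 by (z, u) |-> (z, w), w = sum_k c_k u_k, with
    c_k decreasing so fast that w determines the roots one after the other: u_k is
    nearly (w - sum_(i < k) c_i u_i) / c_k, and Newton's method for u^(-m) = g
    sharpens this value by polynomial operations only.  Hence every u_k is a
    uniform limit of polynomials in z and w, on the image X and even on the
    polynomial hull of X ([hull_sheet]), where the relations between the u_k
    persist; so X equals its hull ([surface_poly_convex]).

    Peak points ([surface_peak_point]).  The functions u_k / u_k(x) with small
    discs around z(x) are bounded, equal to 1 at x, of modulus 1 on the fibre of z
    through x, and tiny away from this fibre.  Multiplied by
    (1 + u_l / u_l(x)) / 2, which separates the points of the fibre, and summed
    with geometric weights along rapidly shrinking discs as in Bishop's criterion
    ([peak_series]), they give a function peaking exactly at x.

    Density ([conj_not_approximable]).  The conjugate of z is not a uniform limit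
    of polynomials on X.  Averaging over all choices of the roots u_k turns a
    polynomial in z and w into a rational function of z with poles in the holes,
    and fixes the conjugate of z.  By compactness only finitely many holes matter,
    and Cauchy's theorem then leads to a contradiction because the total radius of
    the holes is small: the boundary integral of the conjugate is proportional to
    the remaining area, while the boundary has bounded length.  The integral is
    replaced by a finite sum over the pixels of a fine grid that avoid the holes
    ([conj_not_tame_approx]). *)

Set Implicit Arguments.
Unset Strict Implicit.
Unset Printing Implicit Defensive.
Import Order.TTheory GRing.Theory Num.Theory.
Import numFieldNormedType.Exports.
Local Open Scope classical_set_scope.
Local Open Scope ring_scope.

(** * Real-valued moduli *)

Section Modulus.
Variable R : realType.
Implicit Types x y : cplx R.

(** The norm of [cplx R] is itself a complex number; a modulus in [R] lives in a
    totally ordered field, where linear arithmetic applies. *)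
Definition modulus x : R := complex.Re `|x|.
Definition ofreal (r : R) : cplx R := complex.Complex r 0.

Lemma modulusE x : `|x| = ofreal (modulus x).
Proof. by rewrite /modulus /ofreal; case: (x : R[i]%C) => a b. Qed.

Lemma ofrealD : {morph ofreal : r s / r + s}.
Proof. by move=> r s; rewrite /ofreal; apply/eqP; rewrite eq_complex /= addr0 !eqxx. Qed.

Lemma ofrealB : {morph ofreal : r s / r - s}.
Proof. by move=> r s; rewrite /ofreal; apply/eqP; rewrite eq_complex /= subrr !eqxx. Qed.

Lemma ofrealM : {morph ofreal : r s / r * s}.
Proof.
by move=> r s; exact: (rmorphM (GRing.RMorphism.clone _ _ (real_complex R) _) r s).
Qed.

Lemma ofreal_nat n : ofreal n%:R = n%:R.
Proof. by elim: n => [|n IH] //; rewrite -!natr1 ofrealD IH. Qed.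

Lemma ofrealV r : ofreal r^-1 = (ofreal r)^-1.
Proof. exact: (fmorphV (GRing.RMorphism.clone _ _ (real_complex R) _) r). Qed.

Lemma ofreal_Re (r s : R) : complex.Re (ofreal r + 'i * ofreal s) = r.
Proof. by rewrite -complexiE /ofreal /= !mul0r !mulr0 subrr addr0. Qed.

Lemma ofreal_Im (r s : R) : complex.Im (ofreal r + 'i * ofreal s) = s.
Proof. by rewrite -complexiE /ofreal /= !mul0r mul1r !add0r. Qed.

Lemma ofreal_ReIm x : x = ofreal (complex.Re x) + 'i * ofreal (complex.Im x).
Proof. by rewrite -complexiE; exact: complexE. Qed.

Lemma ofreal_le r s : (ofreal r <= ofreal s) = (r <= s).
Proof. exact: lecR. Qed.

Lemma ofreal_lt r s : (ofreal r < ofreal s) = (r < s).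
Proof. exact: ltcR. Qed.

Lemma ofreal_inj : injective ofreal.
Proof. by move=> r s []. Qed.

Lemma ofrealK x : 0 <= x -> ofreal (complex.Re x) = x.
Proof.
move=> x0; have := ger0_Im x0; case: (x : R[i]%C) => a b /= ->; reflexivity.
Qed.

Lemma modulus_ge0 x : 0 <= modulus x.
Proof. by rewrite -ofreal_le -modulusE; exact: normr_ge0. Qed.
Hint Extern 0 (is_true (0 <= modulus _)%R) => solve [exact: modulus_ge0] : core.

Lemma modulusD x y : modulus (x + y) <= modulus x + modulus y.
Proof. by rewrite -ofreal_le ofrealD -!modulusE ler_normD. Qed.

Lemma modulusM x y : modulus (x * y) = modulus x * modulus y.
Proof. by apply: ofreal_inj; rewrite ofrealM -!modulusE normrM. Qed.

Lemma modulusN x : modulus (- x) = modulus x.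
Proof. by rewrite /modulus normrN. Qed.

Lemma modulusB x y : modulus (x - y) = modulus (y - x).
Proof. by rewrite -opprB modulusN. Qed.

Lemma modulusBD x y z : modulus (x - z) <= modulus (x - y) + modulus (y - z).
Proof. by have := modulusD (x - y) (y - z); rewrite addrA subrK. Qed.

Lemma modulusM_le x y (a b : R) :
  modulus x <= a -> modulus y <= b -> modulus (x * y) <= a * b.
Proof. by move=> ha hb; rewrite modulusM ler_pM. Qed.

Lemma modulusD_le x y (a b : R) :
  modulus x <= a -> modulus y <= b -> modulus (x + y) <= a + b.
Proof. by move=> ha hb; apply: le_trans (modulusD _ _) (lerD ha hb). Qed.

Lemma modulus_ler x y : modulus x <= modulus y + modulus (x - y).
Proof. by have := modulusD y (x - y); rewrite addrC subrK. Qed.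

Lemma modulus0 : modulus 0 = 0.
Proof. by rewrite /modulus normr0. Qed.

Lemma modulus1 : modulus 1 = 1.
Proof. by rewrite /modulus normr1. Qed.

Lemma modulus_eq0 x : (modulus x == 0) = (x == 0).
Proof.
rewrite -[RHS]normr_eq0 modulusE; apply/eqP/eqP => [->//|].
by move=> h; apply: ofreal_inj; rewrite h.
Qed.

Lemma modulus_gt0 x : (0 < modulus x) = (x != 0).
Proof. by rewrite lt_def modulus_ge0 andbT modulus_eq0. Qed.

Lemma modulusX x n : modulus (x ^+ n) = modulus x ^+ n.
Proof. by elim: n => [|n IH]; rewrite ?expr0 ?modulus1 // !exprS modulusM IH. Qed.

Lemma modulusV x : modulus x^-1 = (modulus x)^-1.
Proof.
have [->|x0] := eqVneq x 0; first by rewrite invr0 modulus0 invr0.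
apply: (mulfI (x := modulus x)); first by rewrite modulus_eq0.
by rewrite -modulusM mulfV // modulus1 mulfV // modulus_eq0.
Qed.

Lemma modulus_ofreal r : modulus (ofreal r) = `|r|.
Proof. by rewrite /modulus /ofreal normc_def /= expr0n /= addr0 sqrtr_sqr. Qed.

Lemma modulus_i : modulus ('i : cplx R) = 1.
Proof. by apply: ofreal_inj; rewrite -modulusE normCi. Qed.

Lemma modulus_nat n : modulus n%:R = n%:R.
Proof.
by rewrite -ofreal_nat modulus_ofreal normr_nat.
Qed.

Lemma modulus_sum (I : Type) (s : seq I) (P : pred I) (F : I -> cplx R) :
  modulus (\sum_(i <- s | P i) F i) <= \sum_(i <- s | P i) modulus (F i).
Proof.
elim/big_ind2: _ => [|a b c d h1 h2|//]; first by rewrite modulus0.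
by apply: le_trans (modulusD _ _) (lerD h1 h2).
Qed.

Lemma modulus_Re x : `|complex.Re x| <= modulus x.
Proof.
rewrite /modulus normc_def /=; case: (x : R[i]%C) => a b /=.
by rewrite -sqrtr_sqr ler_wsqrtr // lerDl sqr_ge0.
Qed.

Lemma modulus_Im x : `|complex.Im x| <= modulus x.
Proof.
rewrite /modulus normc_def /=; case: (x : R[i]%C) => a b /=.
by rewrite -sqrtr_sqr ler_wsqrtr // lerDr sqr_ge0.
Qed.

Lemma modulus_sqr x : modulus x ^+ 2 = complex.Re x ^+ 2 + complex.Im x ^+ 2.
Proof.
rewrite /modulus normc_def /= sqr_sqrtr // addr_ge0 // sqr_ge0 //.
Qed.

(** Strict convexity: this is what separates two points of a fibre by the function
    (1 + t) / 2. *)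
Lemma modulus_add1_lt2 x : modulus x = 1 -> x <> 1 -> modulus (1 + x) < 2.
Proof.
move=> x1 xn1; rewrite ltNge; apply/negP => h2; apply: xn1.
have := modulus_sqr x; have := modulus_sqr (1 + x); rewrite x1.
set M := modulus (1 + x) in h2 *.
move: M h2 => M h2; case: (x : R[i]%C) => a b /= h3 h4.
have a1 : 1 <= a by nra.
have b0 : b = 0 by apply/eqP; rewrite -sqrf_eq0; apply/eqP; have := sqr_ge0 b; nra.
have ha : a = 1 by rewrite b0 in h4; nra.
by apply/eqP; rewrite eq_complex /= ha b0 !eqxx.
Qed.

Lemma lt_modulus x (e : cplx R) : 0 <= e -> (`|x| < e) = (modulus x < complex.Re e).
Proof. by move=> e0; rewrite -ofreal_lt -modulusE ofrealK. Qed.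

End Modulus.
#[global] Hint Extern 0 (is_true (0 <= modulus _)%R) => solve [exact: modulus_ge0] : core.

(** * Powers and roots *)

Section Small.
Variable R : realType.

Lemma bernoulli (x : R) n : 0 <= x -> 1 + n%:R * x <= (1 + x) ^+ n.
Proof.
move=> x0; elim: n => [|n IH]; first by rewrite expr0 mul0r addr0.
rewrite exprS -natr1.
have n0 : 0 <= (n%:R : R) by [].
apply: le_trans (ler_wpM2l _ IH); last by lra.
have := mulr_ge0 n0 (sqr_ge0 x); nra.
Qed.

Lemma expr_small (l e : R) : 0 <= l < 1 -> 0 < e -> exists n, l ^+ n < e.
Proof.
move=> /andP[l0 l1] e0.
have [->|ln0] := eqVneq l 0; first by exists 1%N; rewrite expr1.
have lp : 0 < l by rewrite lt_def ln0.
set x := l^-1 - 1.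
have xp : 0 < x by rewrite /x subr_gt0 invf_gt1.
set n := (Num.truncn (e^-1 / x)).+1.
have hn : e^-1 / x < n%:R by rewrite truncnS_gt.
exists n.
have h2 := bernoulli n (ltW xp).
have : e^-1 < (1 + x) ^+ n.
  apply: lt_le_trans h2.
  by rewrite ltr_pdivrMr // in hn; lra.
rewrite /x addrC subrK exprVn ltf_pV2 //; exact: exprn_gt0.
Qed.

Lemma le0_of_geometric (a b l : R) :
  0 <= l < 1 -> (forall n, a <= b * l ^+ n) -> a <= 0.
Proof.
move=> hl h; rewrite leNgt; apply/negP => a0.
have b0 : 0 < b by have := h 0%N; rewrite expr0; lra.
have [n hn] := expr_small hl (divr_gt0 a0 b0).
have := h n; rewrite ltr_pdivlMr // in hn; lra.
Qed.

End Small.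

Section Roots.
Variable R : realType.
Local Notation C := (cplx R).

Lemma modulus_root1 (m : nat) (w c : C) :
  (0 < m)%N -> w ^+ m = c -> modulus c = 1 -> modulus w = 1.
Proof.
move=> m0 wc c1; have h : modulus w ^+ m = 1 by rewrite -modulusX wc.
by have := pexpr_eq1 m0 (modulus_ge0 w); rewrite h eqxx => /esym/eqP.
Qed.

(** All exponents of roots below are powers of two, so that the roots are obtained by
    iterated square roots and can be listed explicitly. *)
Fixpoint pow2_roots (j : nat) (c : C) : seq C :=
  if j is j'.+1 then pow2_roots j' (sqrtC c) ++ pow2_roots j' (- sqrtC c)
  else [:: c].

Lemma size_pow2_roots j c : size (pow2_roots j c) = (2 ^ j)%N.
Proof. by elim: j c => [|j IH] c //=; rewrite size_cat !IH expnS mul2n addnn. Qed.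

Lemma pow2_rootsP j c w : w \in pow2_roots j c -> w ^+ (2 ^ j) = c.
Proof.
elim: j c => [|j IH] c /=; first by rewrite inE => /eqP ->.
by rewrite mem_cat expnSr exprM => /orP[] /IH ->; rewrite ?sqrrN sqrtCK.
Qed.

Lemma pow2_root_exists j (c : C) : exists w : C, w ^+ (2 ^ j) = c.
Proof.
have : (0 < size (pow2_roots j c))%N by rewrite size_pow2_roots expn_gt0.
case E : pow2_roots => [|w s] // _; exists w.
by apply: (@pow2_rootsP j); rewrite E inE eqxx.
Qed.

(** The set where z^n is close to c is contained in discs of the sharp radius around
    the n-th roots of c: the bound 1 - (1 - d)^n is about n d, so that the total
    radius of the n discs does not grow with n.  One square root is taken at a time:
    if p^2 is within 1 - D^2 of q^2 with |q| = 1, then |p - q| |p + q| <= (1 - D)(1 + D)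
    while the two factors add up to at least 2, so one of them is at most 1 - D. *)
Lemma pow2_roots_near j (c z : C) (d : R) :
  modulus c = 1 -> 0 <= d <= 1 ->
  modulus (z ^+ (2 ^ j) - c) <= 1 - (1 - d) ^+ (2 ^ j) ->
  exists2 w, w \in pow2_roots j c & modulus (z - w) <= d.
Proof.
move=> c1 /andP[d0 d1]; elim: j c c1 => [|j IH] c c1.
  by rewrite expn0 !expr1 subKr => h; exists c; rewrite ?inE.
rewrite expnSr !exprM; set p := z ^+ _; set D := (1 - d) ^+ _; set q := sqrtC c.
have q1 : modulus q = 1.
  by apply: (@modulus_root1 2 _ c); rewrite ?sqrtCK.
rewrite -{1}(sqrtCK c) -/q subr_sqr modulusM => hpq.
have D0 : 0 <= D by rewrite exprn_ge0 //; lra.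
have D1 : D <= 1 by rewrite exprn_ile1 //; lra.
have hs : 2 <= modulus (p - q) + modulus (p + q).
  have := modulusD (q - p) (p + q); rewrite (modulusB q).
  have -> : q - p + (p + q) = 2%:R * q by ring.
  by rewrite modulusM modulus_nat q1 mulr1.
have [h|h] := leP (modulus (p - q)) (1 - D).
  have [w wi hw] := IH q q1 h.
  by exists w => //=; rewrite mem_cat wi.
have [h'|h'] := leP (modulus (p + q)) (1 - D).
  have q1' : modulus (- q) = 1 by rewrite modulusN.
  have [|w wi hw] := IH (- q) q1'; first by rewrite opprK.
  by exists w => //=; rewrite mem_cat wi orbT.
exfalso.
have : (modulus (p - q) - (1 - D)) * (modulus (p + q) - (1 - D)) > 0.
  by rewrite mulr_gt0 ?subr_gt0.
nra.
Qed.

Lemma expr_taylor (m : nat) (h : C) : modulus h <= 1 ->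
  modulus ((1 + h) ^+ m - 1 - m%:R * h) <= 3 ^+ m * modulus h ^+ 2.
Proof.
move=> h1; elim: m => [|m IH].
  by rewrite !expr0 subrr mul0r subr0 modulus0 mul1r sqr_ge0.
have -> : (1 + h) ^+ m.+1 - 1 - m.+1%:R * h =
   ((1 + h) ^+ m - 1 - m%:R * h) * (1 + h) + m%:R * h ^+ 2.
  rewrite exprS -natr1; ring.
apply: (le_trans (modulusD _ _)).
rewrite 2!modulusM modulus_nat modulusX [3 ^+ m.+1]exprS.
have hh : modulus (1 + h) <= 2.
  by apply: (le_trans (modulusD _ _)); rewrite modulus1; lra.
have hm : (m%:R : R) <= 3 ^+ m.
  by rewrite -natrX ler_nat ltnW // ltn_expl.
have s0 := sqr_ge0 (modulus h).
have := ler_pM (modulus_ge0 _) (modulus_ge0 _) IH hh.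
have := ler_wpM2r s0 hm; lra.
Qed.

Lemma expr_lip (m : nat) (h : C) : modulus h <= 1 ->
  modulus ((1 + h) ^+ m - 1) <= (m%:R + 3 ^+ m) * modulus h.
Proof.
move=> h1; have := expr_taylor m h1.
have := modulus_ler ((1 + h) ^+ m - 1) (m%:R * h).
rewrite modulusM modulus_nat.
have : 3 ^+ m * modulus h ^+ 2 <= (3 ^+ m * modulus h : R).
  apply: ler_wpM2l; first by rewrite exprn_ge0.
  rewrite expr2; apply: ler_piMr; [exact: modulus_ge0|exact: h1].
lra.
Qed.

(** Newton's method for the equation v^(-m) = g.  Written for this equation, rather
    than for g v^m = 1, the step contains no division by v or g: its iterates are
    polynomials in g and v. *)
Definition newton (m : nat) (g v : C) : C := v + v * (1 - g * v ^+ m) / m%:R.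

Definition newton_const (m : nat) : R := 1 + 2 * 3 ^+ m.
(** With relative error at most this radius, each step halves the error. *)
Definition newton_radius (m : nat) : R := (2 * newton_const m)^-1.

Lemma newton_const_ge (m : nat) : 3 <= newton_const m.
Proof.
have : 1 <= 3 ^+ m :> R by rewrite exprn_ege1 //; lra.
by rewrite /newton_const; lra.
Qed.

Lemma newton_radius_gt0 m : 0 < newton_radius m.
Proof. by rewrite invr_gt0; have := newton_const_ge m; lra. Qed.

Lemma newton_radius_le m : newton_radius m <= 1 / 6.
Proof.
have h := newton_const_ge m; rewrite /newton_radius div1r lef_pV2 ?posrE; lra.
Qed.

(** Quadratic convergence, in terms of the relative error h. *)
Lemma newton_step m (g u h : C) : (0 < m)%N -> g * u ^+ m = 1 -> modulus h <= 1 ->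
  exists2 h', newton m g (u * (1 + h)) = u * (1 + h') &
    modulus h' <= newton_const m * modulus h ^+ 2.
Proof.
move=> m0 gu h1.
have mR : (m%:R : C) != 0 by rewrite pnatr_eq0 -lt0n.
set r := ((1 + h) ^+ m - 1 - m%:R * h) / m%:R.
exists (- (h ^+ 2 + (1 + h) * r)).
  rewrite /newton exprMn mulrA gu mul1r /r.
  by field.
rewrite modulusN; apply: (le_trans (modulusD _ _)).
rewrite modulusM modulusX /newton_const.
have hh : modulus (1 + h) <= 2.
  by apply: (le_trans (modulusD _ _)); rewrite modulus1; lra.
have hr : modulus r <= 3 ^+ m * modulus h ^+ 2.
  rewrite /r modulusM modulusV modulus_nat.
  apply: le_trans (expr_taylor m h1); rewrite ler_piMr //.
  by rewrite invf_le1 ?ltr0n // ler1n.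
have := ler_pM (modulus_ge0 _) (modulus_ge0 _) hh hr; lra.
Qed.

Lemma newton_iter m (g u v : C) t : (0 < m)%N -> g * u ^+ m = 1 ->
  modulus (v - u) <= newton_radius m * modulus u ->
  modulus (iter t (newton m g) v - u) <= modulus u * (1 / 2) ^+ t.
Proof.
move=> m0 gu hv.
have u0 : u != 0.
  by apply: contra_eq_neq gu => ->; rewrite expr0n -[m == _]negbK -lt0n m0 mulr0 eq_sym oner_eq0.
have up : 0 < modulus u by rewrite modulus_gt0.
have ra0 := newton_radius_gt0 m; have ra1 := newton_radius_le m.
suff [h -> hh] : exists2 h, iter t (newton m g) v = u * (1 + h) &
    modulus h <= newton_radius m * (1 / 2) ^+ t.
  have -> : u * (1 + h) - u = u * h by ring.
  rewrite modulusM ler_pM2l //; apply: le_trans hh _.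
  by rewrite ler_piMl ?exprn_ge0 //; lra.
elim: t => [|t [h eh hh]].
  exists (v / u - 1); first by rewrite /=; field.
  have -> : v / u - 1 = (v - u) / u by field.
  by rewrite modulusM modulusV expr0 mulr1 ler_pdivrMr.
have p0 : 0 <= (1 / 2 : R) ^+ t by rewrite exprn_ge0 //; lra.
have p1 : (1 / 2 : R) ^+ t <= 1 by rewrite exprn_ile1 //; lra.
have h1 : modulus h <= newton_radius m.
  by apply: le_trans hh _; rewrite ler_piMr // ltW.
have [|h' eh' hh'] := @newton_step m g u h m0 gu; first by lra.
exists h'; first by rewrite iterS eh.
apply: le_trans hh' _.
rewrite [_ ^+ t.+1]exprS [leRHS]mulrCA expr2 mulrA.
apply: ler_pM => //.
  by rewrite mulr_ge0 //; have := newton_const_ge m; lra.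
have := newton_const_ge m => c3.
apply: (@le_trans _ _ (newton_const m * newton_radius m)); first by rewrite ler_pM2l //; lra.
have cn : newton_const m != 0 :> R by rewrite lt0r_neq0 //; lra.
by rewrite /newton_radius invfM mulrCA mulfV // mulr1 div1r.
Qed.

(** The iterates started at v converge to both roots. *)
Lemma newton_unique m (g u u' v : C) : (0 < m)%N -> g * u ^+ m = 1 -> g * u' ^+ m = 1 ->
  modulus (v - u) <= newton_radius m * modulus u ->
  modulus (v - u') <= newton_radius m * modulus u' -> u = u'.
Proof.
move=> m0 gu gu' hu hu'; apply/eqP; rewrite -subr_eq0 -modulus_eq0 eq_le modulus_ge0 andbT.
apply: (@le0_of_geometric _ _ (modulus u + modulus u') (1 / 2)); first by lra.
move=> t; have h1 := newton_iter t m0 gu hu; have h2 := newton_iter t m0 gu' hu'.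
have := modulusBD u (iter t (newton m g) v) u'.
by rewrite (modulusB u (iter _ _ _)); lra.
Qed.

(** A residual |g v^m - 1| below this value forces v to be within the Newton radius of
    an exact root. *)
Definition newton_residual (m : nat) : R := 1 - (1 - newton_radius m) ^+ m.

Lemma newton_residual_ge m : (0 < m)%N -> newton_radius m <= newton_residual m.
Proof.
case: m => // m _; rewrite /newton_residual; set d := newton_radius m.+1.
have d0 : 0 < d := newton_radius_gt0 _; have d1 : d <= _ := newton_radius_le _.
rewrite exprS; have : (1 - d) ^+ m <= 1 by rewrite exprn_ile1 //; lra.
by nra.
Qed.

(** A residual can be estimated on a polynomial hull, whereas a root cannot: this is how
    the roots reappear over the points of the hull. *)
Lemma newton_exists j (g v : C) :
  modulus (g * v ^+ (2 ^ j) - 1) <= newton_residual (2 ^ j) ->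
  exists2 u, g * u ^+ (2 ^ j) = 1 &
    modulus (v - u) <= newton_radius (2 ^ j) * modulus u.
Proof.
set m := (2 ^ j)%N; rewrite /newton_residual.
set d := newton_radius m => hv.
have m0 : (0 < m)%N by rewrite expn_gt0.
have d0 : 0 < d := newton_radius_gt0 _; have d1 : d <= _ := newton_radius_le _.
have g0 : g != 0.
  apply: contraTneq hv => ->; rewrite mul0r add0r modulusN modulus1 -ltNge.
  by rewrite ltrBlDr ltrDl exprn_gt0 //; lra.
have [s hs] := pow2_root_exists j g^-1; rewrite -/m in hs.
have s0 : s != 0.
  apply: contra_eq_neq hs => ->; rewrite expr0n -[m == _]negbK -lt0n m0 /= eq_sym.
  by rewrite invr_eq0.
have [||w wi hw] := @pow2_roots_near j 1 (v / s) d (modulus1 R).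
- lra.
- rewrite expr_div_n hs invrK mulrC; exact: hv.
exists (s * w); first by rewrite exprMn hs (pow2_rootsP wi) mulr1 mulfV.
have w1 : modulus w = 1.
  by apply: (@modulus_root1 m _ 1); rewrite ?(pow2_rootsP wi) ?modulus1.
have -> : v - s * w = s * (v / s - w) by field.
by rewrite !modulusM w1 mulr1 mulrC ler_wpM2r.
Qed.

(** The average of v^j over the roots of v^n = f is f^(j / n) when n divides j and 0
    otherwise.  For n = 2^i the average is taken by halves: averaging over v and -v
    keeps the even powers, which are powers of v^2. *)
Lemma root_average i (s : seq (C * nat)) (f c : C) (e : R) :
  (forall v, v ^+ (2 ^ i) = f -> modulus (\sum_(t <- s) t.1 * v ^+ t.2 - c) <= e) ->
  modulus (\sum_(t <- s | (2 ^ i %| t.2)%N) t.1 * f ^+ (t.2 %/ 2 ^ i) - c) <= e.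
Proof.
elim: i s => [|i IH] s H.
  rewrite expn0; under eq_bigl do rewrite dvd1n.
  by under eq_bigr do rewrite divn1; apply: H; rewrite expn0 expr1.
have -> : \sum_(t <- s | (2 ^ i.+1 %| t.2)%N) t.1 * f ^+ (t.2 %/ 2 ^ i.+1) =
  \sum_(t <- [seq (t.1, t.2 %/ 2)%N | t <- s & (2 %| t.2)%N] | (2 ^ i %| t.2)%N)
     t.1 * f ^+ (t.2 %/ 2 ^ i).
  rewrite big_map big_filter_cond; apply: eq_big => [t|t _] /=; last by rewrite -divnMA -expnS.
  apply/idP/andP => [h|[h2 h]]; last by rewrite expnSr -dvdn_divRL.
  have h2 : (2 %| t.2)%N by apply: dvdn_trans h; rewrite expnS dvdn_mulr.
  by rewrite dvdn_divRL // -expnSr.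
apply: IH => x hx; set v := sqrtC x.
have vE : v ^+ 2 = x by rewrite sqrtCK.
have h1 := H v; have h2 := H (- v).
rewrite !expnS !exprM ?sqrrN vE in h1 h2.
have {}h1 := h1 hx; have {}h2 := h2 hx.
rewrite big_map big_filter.
have -> : \sum_(t <- s | (2 %| t.2)%N) t.1 * x ^+ (t.2 %/ 2) - c =
  ((\sum_(t <- s) t.1 * v ^+ t.2 - c) + (\sum_(t <- s) t.1 * (- v) ^+ t.2 - c)) / 2%:R.
  have -> : forall a b : C, (a - c) + (b - c) = (a + b) - 2%:R * c by move=> a b; ring.
  rewrite -big_split /= mulrBl mulrAC mulfV ?pnatr_eq0 // mul1r; congr (_ - _).
  rewrite mulr_suml big_mkcond; apply: eq_bigr => t _.
  rewrite exprNn -signr_odd dvdn2; case: ifP => [/negbTE od|/negbFE od]; rewrite od.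
    rewrite -vE -exprM mulnC divnK ?dvdn2 ?od // expr0 mul1r.
    by field.
  by rewrite expr1 mulN1r mulrN subrr mul0r.
rewrite modulusM modulusV modulus_nat.
by have := modulusD_le h1 h2; lra.
Qed.

End Roots.

(** * Uniform first-order expansions *)

Section Tame.
Variable R : realType.
Local Notation C := (cplx R).
Variable E : C -> Prop.

(** The only trace of holomorphy that the discrete Cauchy theorem needs: a first-order
    expansion with uniform quadratic error between any two points of [E], whether or
    not [E] contains the segment between them. *)
Definition tame (h : C -> C) := exists (h1 : C -> C) (K : R),
  [/\ 0 <= K, forall p, E p -> modulus (h p) <= K /\ modulus (h1 p) <= K &
   forall p q, E p -> E q -> modulus (h q - h p) <= K * modulus (q - p) /\
     modulus (h q - h p - h1 p * (q - p)) <= K * modulus (q - p) ^+ 2].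

Lemma tame_const c : tame (fun=> c).
Proof.
exists (fun=> 0), (modulus c); split=> // [p _|p q _ _]; first by rewrite modulus0.
by rewrite subrr mul0r subr0 modulus0 !mulr_ge0 // ?sqr_ge0.
Qed.

Lemma tame_id (B : R) : (forall p, E p -> modulus p <= B) -> tame id.
Proof.
move=> hB; exists (fun=> 1), (1 + `|B|).
have b0 : 0 <= `|B| := normr_ge0 _.
split=> [|p /hB hp|p q _ _]; first by lra.
  by rewrite modulus1; have := ler_norm B; lra.
rewrite mul1r subrr modulus0; have := sqr_ge0 (modulus (q - p)); have := modulus_ge0 (q - p).
by move=> h0 h1; split; nra.
Qed.

Lemma tameD h k : tame h -> tame k -> tame (fun z => h z + k z).
Proof.
move=> [h1 [K [K0 hK1 hK2]]] [k1 [L [L0 hL1 hL2]]].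
exists (fun z => h1 z + k1 z), (K + L); split; first by lra.
  move=> p Ep; have [a b] := hK1 p Ep; have [c d] := hL1 p Ep.
  have := modulusD (h p) (k p); have := modulusD (h1 p) (k1 p); lra.
move=> p q Ep Eq; have [a b] := hK2 p q Ep Eq; have [c d] := hL2 p q Ep Eq.
have -> : h q + k q - (h p + k p) = (h q - h p) + (k q - k p) by ring.
have -> : (h q - h p) + (k q - k p) - (h1 p + k1 p) * (q - p) =
  (h q - h p - h1 p * (q - p)) + (k q - k p - k1 p * (q - p)) by ring.
rewrite !mulrDl; split; apply: le_trans (modulusD _ _) _; exact: lerD.
Qed.

Lemma tameM h k : tame h -> tame k -> tame (fun z => h z * k z).
Proof.
move=> [h1 [K [K0 hK1 hK2]]] [k1 [L [L0 hL1 hL2]]].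
exists (fun z => h1 z * k z + h z * k1 z), (3 * (K * L)).
have KL : 0 <= K * L by rewrite mulr_ge0.
split; first by lra.
  move=> p Ep; have [a b] := hK1 p Ep; have [c d] := hL1 p Ep.
  split; first by apply: le_trans (modulusM_le a c) _; lra.
  by apply: le_trans (modulusD_le (modulusM_le b c) (modulusM_le a d)) _; lra.
move=> p q Ep Eq; have [a b] := hK2 p q Ep Eq; have [c d] := hL2 p q Ep Eq.
have [hp h1p] := hK1 p Ep; have [kq k1q] := hL1 q Eq.
have D0 : 0 <= modulus (q - p) := modulus_ge0 _.
split.
  have -> : h q * k q - h p * k p = (h q - h p) * k q + h p * (k q - k p) by ring.
  apply: le_trans (modulusD_le (modulusM_le a kq) (modulusM_le hp c)) _.
  by have := mulr_ge0 KL D0; lra.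
have -> : h q * k q - h p * k p - (h1 p * k p + h p * k1 p) * (q - p) =
  (h q - h p - h1 p * (q - p)) * k q + h p * (k q - k p - k1 p * (q - p))
  + h1 p * (q - p) * (k q - k p) by ring.
apply: le_trans (modulusD_le (modulusD_le (modulusM_le b kq) (modulusM_le hp d))
  (modulusM_le (modulusM_le h1p (lexx _)) c)) _.
lra.
Qed.

Lemma tameX h n : tame h -> tame (fun z => h z ^+ n).
Proof.
move=> th; elim: n => [|n IH].
  have := tame_const 1; congr tame; apply/funext => z; by rewrite expr0.
have := tameM th IH; congr tame; apply/funext => z; by rewrite exprS.
Qed.

Lemma tameV h (b : R) : 0 < b -> (forall p, E p -> b <= modulus (h p)) ->
  tame h -> tame (fun z => (h z)^-1).
Proof.
move=> b0 hb [h1 [K [K0 hK1 hK2]]].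
have h0 p : E p -> h p != 0.
  by move=> /hb; rewrite -modulus_gt0; apply: lt_le_trans.
have iv p : E p -> modulus (h p)^-1 <= b^-1.
  by move=> Ep; rewrite modulusV lef_pV2 ?posrE ?modulus_gt0 ?h0 //; exact: hb.
have c0 : 0 < b^-1 by rewrite invr_gt0.
have iv2 p q : E p -> E q -> modulus ((h p)^-1 * (h q)^-1) <= b^-1 * b^-1.
  by move=> /iv Ep /iv Eq; rewrite modulusM ler_pM.
set c := b^-1 in iv c0 iv2.
have c20 : 0 <= c * c by rewrite mulr_ge0 // ltW.
have cK0 : 0 <= c * c * K by rewrite mulr_ge0.
have cK1 : 0 <= c * c * c * (K * K) by rewrite !mulr_ge0 // ltW.
exists (fun z => - h1 z * ((h z)^-1 * (h z)^-1)), (c + c * c * K + 2 * (c * c * c * (K * K))).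
split; first by rewrite !addr_ge0 ?mulr_ge0 // ltW.
  move=> p Ep; have [a e] := hK1 p Ep.
  split; first by apply: le_trans (iv _ Ep) _; lra.
  rewrite modulusM modulusN mulrC.
  have := ler_pM (modulus_ge0 _) (modulus_ge0 _) (iv2 p p Ep Ep) e; lra.
move=> p q Ep Eq; have [hp h1p] := hK1 p Ep; have [hq h1q] := hK1 q Eq.
have [a e] := hK2 p q Ep Eq.
set D := modulus (q - p) in a e *.
have D0 : 0 <= D := modulus_ge0 _.
have D2 : 0 <= D ^+ 2 := sqr_ge0 _.
have hp0 := h0 p Ep; have hq0 := h0 q Eq.
have iv3 : modulus (- ((h p)^-1 * (h q)^-1)) <= c * c by rewrite modulusN; exact: iv2.
split.
  have -> : (h q)^-1 - (h p)^-1 = (h q - h p) * - ((h p)^-1 * (h q)^-1).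
    by field; rewrite hp0 hq0.
  have := modulusM_le a iv3.
  have := mulr_ge0 (ltW c0) D0; have := mulr_ge0 cK1 D0; lra.
have -> : (h q)^-1 - (h p)^-1 - - h1 p * ((h p)^-1 * (h p)^-1) * (q - p) =
  (h q - h p - h1 p * (q - p)) * - ((h p)^-1 * (h q)^-1)
   + h1 p * (q - p) * (h q - h p) * ((h p)^-1 * (h q)^-1 * (h p)^-1).
  by field; rewrite hp0 hq0.
have e1 := modulusM_le e iv3.
have e2 := modulusM_le (modulusM_le (modulusM_le h1p (lexx (modulus (q - p)))) a)
  (modulusM_le (iv2 p q Ep Eq) (iv p Ep)).
apply: le_trans (modulusD_le e1 e2) _; rewrite -/D.
have := mulr_ge0 (ltW c0) D2; have := mulr_ge0 cK1 D2; lra.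
Qed.
End Tame.

(** * A discrete Cauchy theorem *)

Section Pixels.
Variable R : realType.
Local Notation C := (cplx R).

Definition shifted (chi : nat -> bool) (b : nat) := (0 < b)%N && chi b.-1.
Definition truncated (n : nat) (chi : nat -> bool) (b : nat) := (b < n)%N && chi b.
(** The variation of the indicator of [chi], cut off outside the range 0 .. n - 1. *)
Definition variation (n : nat) (chi : nat -> bool) : nat :=
  \sum_(b < n.+1) (truncated n chi b (+) shifted chi b).

(** Summation by parts: the differences of [H] inside a run of [chi] cancel, and only the
    ends of the runs contribute.  This is the cancellation of adjacent contours. *)
Lemma abel_bound n (chi : nat -> bool) (H : nat -> C) (e : R) :
  (forall b, (b < n)%N -> chi b -> modulus (H b) <= e /\ modulus (H b.+1) <= e) ->
  modulus (\sum_(b < n) (chi b)%:R * (H b - H b.+1)) <= (variation n chi)%:R * e.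
Proof.
move=> hH.
have -> : \sum_(b < n) (chi b)%:R * (H b - H b.+1) =
   \sum_(b < n.+1) ((truncated n chi b)%:R - (shifted chi b)%:R) * H b.
  under eq_bigr do rewrite mulrBr; rewrite sumrB.
  under [RHS]eq_bigr do rewrite mulrBl; rewrite sumrB; congr (_ - _).
    rewrite big_ord_recr /= /truncated ltnn mul0r addr0; apply: eq_bigr => b _.
    by rewrite ltn_ord.
  by rewrite big_ord_recl /= /shifted /= mul0r add0r; apply: eq_bigr.
rewrite /variation natr_sum mulr_suml.
apply: le_trans (modulus_sum _ _ _) _; apply: ler_sum => b _.
have hc : truncated n chi b || shifted chi b -> modulus (H b) <= e.
  move=> /orP[/andP[bn cb]|/andP[b0 cb]]; first by have [] := hH _ bn cb.
  by have [|_] := hH b.-1 _ cb; rewrite prednK // -ltnS ltn_ord.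
case: (truncated _ _ _) hc; case: (shifted _ _) => /= hc;
  rewrite ?subrr ?subr0 ?sub0r ?mul0r ?modulus0 ?mul1r ?mulN1r ?modulusN //; exact: hc.
Qed.

Definition in_block (I : nat * nat) (a : nat) : bool := (I.1 <= a < I.1 + I.2)%N.
Definition avoids (s : seq (nat * nat)) (b : nat) : bool := all (fun I => ~~ in_block I b) s.

Lemma sum_pred1_le n (c : nat) : (\sum_(b < n) ((b : nat) == c) <= 1)%N.
Proof.
elim: n => [|n IH]; first by rewrite big_ord0.
rewrite big_ord_recr /=; have [->|_] := eqVneq n c; last by rewrite addn0.
rewrite big1 // => i _; apply/eqP; rewrite eqb0; apply/eqP => h.
by have := ltn_ord i; rewrite h ltnn.
Qed.

(** Each excluded block creates at most two new ends of runs. *)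
Lemma variation_avoids n s : (variation n (avoids s) <= 2 + 2 * size s)%N.
Proof.
elim: s => [|I s IH] /=.
  rewrite muln0 addn0 /variation.
  apply: (@leq_trans (\sum_(b < n.+1) (((b : nat) == 0) + ((b : nat) == n)))).
    apply: leq_sum => b _; rewrite /truncated /shifted /avoids /= !andbT.
    have := ltn_ord b; rewrite ltnS leq_eqVlt lt0n => /orP[/eqP ->|bn].
      by rewrite ltnn eqxx; case: eqP.
    by rewrite bn; case: eqP.
  by rewrite big_split /= (@leq_add _ _ 1 1) // sum_pred1_le.
apply: (@leq_trans (variation n (avoids s) + \sum_(b < n.+1) (((b : nat) == I.1) + ((b : nat) == I.1 + I.2)%N))).
  rewrite /variation -big_split /=; apply: leq_sum => b _.
  have cE x : avoids (I :: s) x = ~~ in_block I x && avoids s x by [].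
  rewrite /truncated /shifted !cE.
  case: (avoids s b); case: (avoids s b.-1); rewrite ?andbF ?andbT /=.
  - rewrite /in_block; case: (posnP b) => [->|b0] //=; lia.
  - by case: (b < n)%N; case: in_block.
  - by case: (0 < b)%N; case: in_block.
  - by [].
have h2 : (\sum_(b < n.+1) (((b : nat) == I.1) + ((b : nat) == I.1 + I.2)%N) <= 1 + 1)%N.
  by rewrite big_split /= leq_add // sum_pred1_le.
by apply: leq_trans (leq_add IH h2) _; rewrite mulnS; lia.
Qed.

Lemma sum_in_block_le n (I : nat * nat) : (\sum_(a < n) in_block I a <= I.2)%N.
Proof.
apply: (@leq_trans (\sum_(a < n) \sum_(c < I.2) ((a : nat) == I.1 + c)%N)).
  apply: leq_sum => a _; rewrite /in_block; case: andP => // -[h1 h2].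
  have hc : (a - I.1 < I.2)%N by lia.
  by rewrite (bigD1 (Ordinal hc)) //= subnKC // eqxx.
rewrite exchange_big /=; apply: (@leq_trans (\sum_(c < I.2) 1)%N).
  by apply: leq_sum => c _; exact: sum_pred1_le.
by rewrite sum_nat_const card_ord muln1.
Qed.

(** A list of rectangles I x J of pixels, one around each hole: the blocks of column [a]
    (resp. of row [b]) are the sides of the rectangles that meet it. *)
Definition column_blocks (s : seq ((nat * nat) * (nat * nat))) (a : nat) :=
  [seq r.2 | r <- s & in_block r.1 a].
Definition row_blocks (s : seq ((nat * nat) * (nat * nat))) (b : nat) :=
  [seq r.1 | r <- s & in_block r.2 b].

Lemma avoids_swap s a b : avoids (column_blocks s a) b = avoids (row_blocks s b) a.
Proof.
rewrite /avoids !all_map !all_filter; apply: eq_all => r /=.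
by case: in_block; case: in_block.
Qed.

Lemma sum_variation_le n (f : nat -> seq (nat * nat)) (s : seq ((nat * nat) * (nat * nat)))
    (pr : (nat * nat) * (nat * nat) -> nat * nat) :
  (forall a, size (f a) = count (fun r => in_block (pr r) a) s) ->
  (\sum_(a < n) variation n (avoids (f a)) <= 2 * n + 2 * \sum_(r <- s) (pr r).2)%N.
Proof.
move=> hf; apply: (@leq_trans (\sum_(a < n) (2 + 2 * \sum_(r <- s) in_block (pr r) a))%N).
  apply: leq_sum => a _; apply: leq_trans (variation_avoids _ _) _.
  by rewrite hf -sum1_count big_mkcond.
rewrite big_split /= sum_nat_const card_ord mulnC leq_add2l -big_distrr /= leq_mul2l /=.
by rewrite exchange_big /=; apply: leq_sum => r _; exact: sum_in_block_le.
Qed.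

Lemma sum_avoids_ge n s :
  (n * n <= \sum_(a < n) \sum_(b < n) avoids (column_blocks s a) b + \sum_(r <- s) r.1.2 * r.2.2)%N.
Proof.
apply: (@leq_trans (\sum_(a < n) \sum_(b < n)
   (avoids (column_blocks s a) b + \sum_(r <- s) in_block r.1 a * in_block r.2 b))%N).
  rewrite -{1}[n]card_ord -sum_nat_const; apply: leq_sum => a _.
  rewrite -{1}[n]card_ord -[#|_|]muln1 -sum_nat_const; apply: leq_sum => b _.
  rewrite /avoids /column_blocks all_map all_filter.
  elim: s => [|r s IH] //=; rewrite big_cons /=.
  case: in_block; case: in_block => //=; rewrite ?mul0n ?muln0 ?add0n //.
have -> : (\sum_(a < n) \sum_(b < n)
   (avoids (column_blocks s a) b + \sum_(r <- s) in_block r.1 a * in_block r.2 b) =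
   \sum_(a < n) \sum_(b < n) avoids (column_blocks s a) b +
   \sum_(a < n) \sum_(b < n) \sum_(r <- s) in_block r.1 a * in_block r.2 b)%N.
  by rewrite -big_split /=; apply: eq_bigr => a _; rewrite big_split.
rewrite leq_add2l.
have -> : (\sum_(a < n) \sum_(b < n) \sum_(r <- s) in_block r.1 a * in_block r.2 b =
   \sum_(r <- s) \sum_(a < n) \sum_(b < n) in_block r.1 a * in_block r.2 b)%N.
  by rewrite [RHS]exchange_big /=; apply: eq_bigr => a _; rewrite exchange_big.
apply: leq_sum => r _.
apply: (@leq_trans ((\sum_(a < n) in_block r.1 a) * r.2.2)%N).
  rewrite big_distrl /=; apply: leq_sum => a _.
  by rewrite -big_distrr /= leq_mul2l sum_in_block_le orbT.
by rewrite leq_mul2r sum_in_block_le orbT.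
Qed.

Definition lattice_point (n a b : nat) : C := a%:R / n%:R + 'i * (b%:R / n%:R).

Lemma lattice_point_conj n a b : (lattice_point n a b)^* = a%:R / n%:R - 'i * (b%:R / n%:R).
Proof.
by rewrite /lattice_point rmorphD rmorphM /= conjCi !fmorph_div !rmorph_nat mulNr.
Qed.

Lemma lattice_point_step n a b a' b' : (0 < n)%N ->
  lattice_point n (a + a') (b + b') = lattice_point n a b + (a'%:R + 'i * b'%:R) / n%:R.
Proof. by move=> n0; rewrite /lattice_point !natrD; field; rewrite pnatr_eq0 -lt0n. Qed.

Lemma lattice_point_ofreal n a b : lattice_point n a b = ofreal (a%:R / n%:R) + 'i * ofreal (b%:R / n%:R).
Proof. by rewrite !ofrealM !ofrealV !ofreal_nat. Qed.

Lemma lattice_point_Re n a b : complex.Re (lattice_point n a b) = a%:R / n%:R.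
Proof. by rewrite lattice_point_ofreal ofreal_Re. Qed.

Lemma lattice_point_Im n a b : complex.Im (lattice_point n a b) = b%:R / n%:R.
Proof. by rewrite lattice_point_ofreal ofreal_Im. Qed.

(** Up to the factor 1 / (2 n), the trapezoidal value of the integral of [h] along the
    boundary of the pixel with lower left corner (a, b). *)
Definition contour (h : nat -> nat -> C) (a b : nat) : C :=
  (h a b + h a.+1 b - (h a b.+1 + h a.+1 b.+1)) +
  'i * (h a.+1 b + h a.+1 b.+1 - (h a b + h a b.+1)).

(** The sum of the contours of the free pixels only sees the boundary of their union,
    whose length is at most that of the square and of the rectangles. *)
Lemma contour_sum_bound n s (h : nat -> nat -> C) (e : R) :
  (forall a b, (a < n)%N -> (b < n)%N -> avoids (column_blocks s a) b ->
    [/\ modulus (h a b) <= e, modulus (h a.+1 b) <= e,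
        modulus (h a b.+1) <= e & modulus (h a.+1 b.+1) <= e]) ->
  0 <= e ->
  modulus (\sum_(a < n) \sum_(b < n) (avoids (column_blocks s a) b)%:R * contour h a b) <=
  (4 * n + 2 * \sum_(r <- s) (r.1.2 + r.2.2))%:R * (2 * e).
Proof.
move=> hh e0.
have -> : \sum_(a < n) \sum_(b < n) (avoids (column_blocks s a) b)%:R * contour h a b =
  \sum_(a < n) \sum_(b < n) (avoids (column_blocks s a) b)%:R *
     ((h a b + h a.+1 b) - (h a b.+1 + h a.+1 b.+1)) +
  'i * - \sum_(b < n) \sum_(a < n) (avoids (row_blocks s b) a)%:R *
     ((h a b + h a b.+1) - (h a.+1 b + h a.+1 b.+1)).
  rewrite [X in _ = _ + 'i * - X]exchange_big /= -sumrN mulr_sumr -big_split /=.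
  apply: eq_bigr => a _; rewrite -sumrN mulr_sumr -big_split /=; apply: eq_bigr => b _.
  by rewrite avoids_swap /contour; ring.
have h1 : modulus (\sum_(a < n) \sum_(b < n) (avoids (column_blocks s a) b)%:R *
     ((h a b + h a.+1 b) - (h a b.+1 + h a.+1 b.+1))) <=
     (2 * n + 2 * \sum_(r <- s) r.1.2)%:R * (2 * e).
  apply: le_trans (modulus_sum _ _ _) _.
  apply: (@le_trans _ _ (\sum_(a < n) (variation n (avoids (column_blocks s a)))%:R * (2 * e))).
    apply: ler_sum => a _; apply: (@abel_bound n _ (fun b => h a b + h a.+1 b)) => b bn cb.
    have [p1 p2 p3 p4] := hh a b (ltn_ord a) bn cb.
    by rewrite mulr_natl mulr2n !modulusD_le.
  rewrite -mulr_suml -natr_sum ler_wpM2r ?mulr_ge0 // ler_nat.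
  by apply: (@sum_variation_le _ _ _ fst) => a; rewrite size_map size_filter.
have h2 : modulus (\sum_(b < n) \sum_(a < n) (avoids (row_blocks s b) a)%:R *
     ((h a b + h a b.+1) - (h a.+1 b + h a.+1 b.+1))) <=
     (2 * n + 2 * \sum_(r <- s) r.2.2)%:R * (2 * e).
  apply: le_trans (modulus_sum _ _ _) _.
  apply: (@le_trans _ _ (\sum_(b < n) (variation n (avoids (row_blocks s b)))%:R * (2 * e))).
    apply: ler_sum => b _; apply: (@abel_bound n _ (fun a => h a b + h a b.+1)) => a an ca.
    rewrite -avoids_swap in ca; have [p1 p2 p3 p4] := hh a b an (ltn_ord b) ca.
    by rewrite mulr_natl mulr2n !modulusD_le.
  rewrite -mulr_suml -natr_sum ler_wpM2r ?mulr_ge0 // ler_nat.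
  by apply: (@sum_variation_le _ _ _ snd) => b; rewrite size_map size_filter.
apply: le_trans (modulusD _ _) _; rewrite modulusM modulus_i mul1r modulusN.
apply: le_trans (lerD h1 h2) _; rewrite -mulrDl -natrD ler_wpM2r ?mulr_ge0 // ler_nat.
rewrite big_split /=; lia.
Qed.

(** Affine functions have contour 0, so that only the quadratic error remains. *)
Lemma contour_tame (E : C -> Prop) (g g1 : C -> C) (K : R) n a b :
  (forall p q, E p -> E q ->
     modulus (g q - g p - g1 p * (q - p)) <= K * modulus (q - p) ^+ 2) ->
  0 <= K -> (0 < n)%N ->
  E (lattice_point n a b) -> E (lattice_point n a.+1 b) -> E (lattice_point n a b.+1) -> E (lattice_point n a.+1 b.+1) ->
  modulus (contour (fun a b => g (lattice_point n a b)) a b) <= 24 * K / n%:R ^+ 2.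
Proof.
move=> hK K0 n0 E0 E1 E3 E2.
have n0' : 0 < n%:R :> R by rewrite ltr0n.
rewrite /contour.
have est q t : modulus t <= 2 -> E q -> q = lattice_point n a b + t / n%:R ->
    modulus (g q - g (lattice_point n a b) - g1 (lattice_point n a b) * (t / n%:R)) <= 4 * K / n%:R ^+ 2.
  move=> t2 Eq qE; have := hK _ _ E0 Eq.
  have -> : q - lattice_point n a b = t / n%:R by rewrite qE addrC addKr.
  move=> h; apply: le_trans h _.
  rewrite modulusM modulusV modulus_nat exprMn exprVn.
  have t4 : modulus t ^+ 2 <= 4 by have := modulus_ge0 t; nra.
  have c0 : 0 <= K * (n%:R ^+ 2)^-1 by rewrite mulr_ge0 ?invr_ge0 ?exprn_ge0.
  by have := ler_wpM2l c0 t4; lra.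
have i1 := modulus_i.
have e1 := est _ 1 _ E1 _; have e2 := est _ (1 + 'i) _ E2 _; have e3 := est _ 'i _ E3 _.
have {}e1 : modulus (g (lattice_point n a.+1 b) - g (lattice_point n a b) - g1 (lattice_point n a b) * (1 / n%:R)) <= 4 * K / n%:R ^+ 2.
  apply: e1; first by rewrite modulus1; lra.
  by rewrite -[a.+1]addn1 -{1}[b]addn0 lattice_point_step // mulr0 addr0.
have {}e2 : modulus (g (lattice_point n a.+1 b.+1) - g (lattice_point n a b) - g1 (lattice_point n a b) * ((1 + 'i) / n%:R)) <= 4 * K / n%:R ^+ 2.
  apply: e2; first by apply: le_trans (modulusD _ _) _; rewrite modulus1 modulus_i; lra.
  by rewrite -[a.+1]addn1 -[b.+1]addn1 lattice_point_step // mulr1.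
have {}e3 : modulus (g (lattice_point n a b.+1) - g (lattice_point n a b) - g1 (lattice_point n a b) * ('i / n%:R)) <= 4 * K / n%:R ^+ 2.
  apply: e3; first by rewrite modulus_i; lra.
  by rewrite -[b.+1]addn1 -{1}[a]addn0 lattice_point_step // mulr1 add0r.
set r1 := (X in modulus X <= _) in e1; set r2 := (X in modulus X <= _) in e2.
set r3 := (X in modulus X <= _) in e3.
have m1 : modulus (1 + 'i : C) <= 2 by apply: le_trans (modulusD _ _) _; rewrite modulus1 modulus_i; lra.
have m2 : modulus (-1 + 'i : C) <= 2.
  by apply: le_trans (modulusD _ _) _; rewrite modulusN modulus1 modulus_i; lra.
have m3 : modulus (-1 - 'i : C) <= 2.
  by apply: le_trans (modulusD _ _) _; rewrite !modulusN modulus1 modulus_i; lra.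
have -> : g (lattice_point n a b) + g (lattice_point n a.+1 b) - (g (lattice_point n a b.+1) + g (lattice_point n a.+1 b.+1)) +
   'i * (g (lattice_point n a.+1 b) + g (lattice_point n a.+1 b.+1) - (g (lattice_point n a b) + g (lattice_point n a b.+1))) =
   (1 + 'i) * r1 + (-1 + 'i) * r2 + (-1 - 'i) * r3.
  by rewrite /r1 /r2 /r3; ring.
apply: le_trans (modulusD_le (modulusD_le (modulusM_le m1 e1) (modulusM_le m2 e2)) (modulusM_le m3 e3)) _.
lra.
Qed.

Lemma contour_conj n a b : (0 < n)%N -> contour (fun a b => (lattice_point n a b)^*) a b = 4%:R * 'i / n%:R.
Proof.
move=> n0; rewrite /contour !lattice_point_conj -!natr1; field.
by rewrite pnatr_eq0 -lt0n.
Qed.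

(* natural numbers within L of x *)
Lemma block_around (x L : R) : 0 <= L -> exists I : nat * nat,
  I.2%:R <= 2 * L + 2 /\ forall a : nat, `|a%:R - x| <= L -> in_block I a.
Proof.
move=> L0; exists (Num.truncn (x - L), (Num.truncn (2 * L)).+2); split=> /=.
  rewrite -addn2 natrD lerD2r; have := truncn_itv (mulr_ge0 _ L0).
  by move=> /(_ 2 (ler0n _ _))/andP[].
move=> a; rewrite ler_distl => /andP[h1 h2]; rewrite /in_block /=; apply/andP; split.
  by rewrite truncn_le_nat -natr1; lra.
have h3 := truncnS_gt (x - L); have h4 := truncnS_gt (2 * L).
by rewrite -(ltr_nat R) natrD -addn1 natrD; rewrite -!natr1 in h3 h4 *; lra.
Qed.

(** On the unit square minus holes of total radius at most 1 / 64, no [g] with uniform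
    first-order expansions is within 1 / 4 of the conjugation.  With mesh 1 / n, the
    contours of [g] add up to o(n), those of the conjugation to 4 i / n times the number
    of free pixels, which is at least (255 / 256) n^2, and the sum for the difference is
    at most (17 / 8) n. *)
Lemma conj_not_tame_approx (E : C -> Prop) (g : C -> C) (holes : seq (C * R)) :
  tame E g -> (forall h, h \in holes -> 0 <= h.2) ->
  \sum_(h <- holes) h.2 <= 1 / 64 ->
  (forall z : C, 0 <= complex.Re z <= 1 -> 0 <= complex.Im z <= 1 ->
     (forall h, h \in holes -> h.2 < modulus (z - h.1)) ->
     E z /\ modulus (g z - z^*) <= 1 / 4) ->
  False.
Proof.
move=> [g1 [K [K0 hK1 hK2]]] h0 hsum hE.
set N := size holes.
set n := (Num.truncn (128 * N%:R + 24 * K)).+1.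
have n0 : (0 < n)%N by [].
have n0' : 0 < n%:R :> R by rewrite ltr0n.
have hn : 128 * N%:R + 24 * K < n%:R := truncnS_gt _.
have N0 : 0 <= N%:R :> R by [].
have /choice [f hf] : forall h : C * R, exists r : (nat * nat) * (nat * nat), 0 <= h.2 ->
   [/\ r.1.2%:R <= 2 * n%:R * h.2 + 4, r.2.2%:R <= 2 * n%:R * h.2 + 4,
     forall a : nat, `|a%:R - n%:R * complex.Re h.1| <= n%:R * h.2 + 1 -> in_block r.1 a &
     forall b : nat, `|b%:R - n%:R * complex.Im h.1| <= n%:R * h.2 + 1 -> in_block r.2 b].
  move=> h; have [hp|hn0] := boolP (0 <= h.2); last by exists ((0, 0), (0, 0))%N.
  have L0 : 0 <= n%:R * h.2 + 1 by rewrite addr_ge0 // mulr_ge0.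
  have [I [I1 I2]] := block_around (n%:R * complex.Re h.1) L0.
  have [J [J1 J2]] := block_around (n%:R * complex.Im h.1) L0.
  by exists (I, J) => _; split => //=; lra.
set s := map f holes.
have len (pr : (nat * nat) * (nat * nat) -> nat) :
    (forall h, h \in holes -> (pr (f h))%:R <= 2 * n%:R * h.2 + 4) ->
    (\sum_(r <- s) pr r)%:R <= n%:R / 16 :> R.
  move=> hpr; rewrite natr_sum /s big_map.
  apply: (@le_trans _ _ (\sum_(h <- holes) (2 * n%:R * h.2 + 4))).
    by rewrite !big_seq; apply: ler_sum => h hh; exact: hpr.
  rewrite big_split /= -mulr_sumr big_const_seq count_predT iter_addr_0 -/N.
  rewrite -mulr_natr; have := ler_wpM2l (ltW n0') hsum; lra.
have lenI := len (fun r => r.1.2) (fun h hh => let: And4 p _ _ _ := hf h (h0 h hh) in p).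
have lenJ := len (fun r => r.2.2) (fun h hh => let: And4 _ p _ _ := hf h (h0 h hh) in p).
rewrite /= in lenI lenJ.
have good a b a' b' : (a < n)%N -> (b < n)%N -> avoids (column_blocks s a) b ->
    (a <= a' <= a.+1)%N -> (b <= b' <= b.+1)%N ->
    E (lattice_point n a' b') /\ modulus (g (lattice_point n a' b') - (lattice_point n a' b')^*) <= 1 / 4.
  move=> an bn cab /andP[ha1 ha2] /andP[hb1 hb2].
  have sc (x x' : nat) (y : R) : (x <= x')%N -> (x' <= x.+1)%N -> forall rho,
      `|x'%:R / n%:R - y| <= rho -> `|x%:R - n%:R * y| <= n%:R * rho + 1.
    rewrite -!(ler_nat R) -natr1 => x1 x2 rho hr.
    have : `|x'%:R - n%:R * y| <= n%:R * rho.
      have -> : x'%:R - n%:R * y = n%:R * (x'%:R / n%:R - y) by field; rewrite pnatr_eq0.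
      by rewrite normrM ger0_norm // ler_pM2l.
    by rewrite !ler_distl => /andP[? ?]; apply/andP; split; lra.
  have unit01 (x x' : nat) : (x < n)%N -> (x' <= x.+1)%N -> 0 <= (x'%:R / n%:R : R) <= 1.
    move=> xn xx; rewrite divr_ge0 //= ler_pdivrMr // mul1r ler_nat.
    exact: leq_trans xx xn.
  apply: hE; rewrite ?lattice_point_Re ?lattice_point_Im.
  - exact: unit01 an ha2.
  - exact: unit01 bn hb2.
  move=> h hh; rewrite ltNge; apply/negP => hd.
  have [_ _ hI hJ] := hf h (h0 h hh).
  have dRe := le_trans (modulus_Re _) hd; have dIm := le_trans (modulus_Im _) hd.
  have iI : in_block (f h).1 a.
    by apply: hI; apply: sc ha1 ha2 _ _; move: dRe; rewrite -(lattice_point_Re n a' b') raddfB.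
  have iJ : in_block (f h).2 b.
    by apply: hJ; apply: sc hb1 hb2 _ _; move: dIm; rewrite -(lattice_point_Im n a' b') raddfB.
  move: cab; rewrite /avoids /column_blocks all_map all_filter => /allP /(_ (f h)).
  by rewrite map_f //= iI iJ => /(_ isT).
set Gd := (\sum_(a < n) \sum_(b < n) avoids (column_blocks s a) b)%N.
have hGd : n%:R ^+ 2 * (255 / 256) <= Gd%:R :> R.
  have := sum_avoids_ge n s; rewrite -(ler_nat R) natrD natrM -/Gd.
  have : (\sum_(r <- s) r.1.2 * r.2.2 <= (\sum_(r <- s) r.1.2) * (\sum_(r <- s) r.2.2))%N.
    elim: (s) => [|r t IH]; first by rewrite !big_nil.
    rewrite !big_cons mulnDl !mulnDr; lia.
  rewrite -(ler_nat R) [X in _ <= X]natrM => h1.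
  have h2 : (\sum_(r <- s) r.1.2)%:R * (\sum_(r <- s) r.2.2)%:R <= n%:R / 16 * (n%:R / 16) :> R.
    by apply: ler_pM.
  lra.
pose e a b := g (lattice_point n a b) - (lattice_point n a b)^*.
have up := @contour_sum_bound n s e (1 / 4) _ _.
have {}up : modulus (\sum_(a < n) \sum_(b < n) (avoids (column_blocks s a) b)%:R * contour e a b) <=
   (17 / 8) * n%:R.
  apply: le_trans (up _ _) _; last 1 first.
  - rewrite big_split /= natrD !natrM natrD; lra.
  - move=> a b an bn c; split.
    + by have [] := good a b a b an bn c; rewrite ?leqnn ?leqnSn.
    + by have [] := good a b a.+1 b an bn c; rewrite ?leqnn ?leqnSn.
    + by have [] := good a b a b.+1 an bn c; rewrite ?leqnn ?leqnSn.
    + by have [] := good a b a.+1 b.+1 an bn c; rewrite ?leqnn ?leqnSn.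
  - lra.
have low : modulus (\sum_(a < n) \sum_(b < n) (avoids (column_blocks s a) b)%:R *
    (contour e a b + 4%:R * 'i / n%:R)) <= Gd%:R * (24 * K / n%:R ^+ 2).
  rewrite natr_sum mulr_suml; apply: le_trans (modulus_sum _ _ _) _; apply: ler_sum => a _.
  rewrite natr_sum mulr_suml; apply: le_trans (modulus_sum _ _ _) _; apply: ler_sum => b _.
  rewrite modulusM modulus_nat.
  case c: (avoids _ _); last by rewrite !mul0r.
  rewrite !mul1r.
  have -> : contour e a b + 4%:R * 'i / n%:R = contour (fun a b => g (lattice_point n a b)) a b.
    by rewrite -(contour_conj a b n0) /contour /e; ring.
  apply: (@contour_tame E _ g1) => //.
  - by move=> p q Ep Eq; have [] := hK2 p q Ep Eq.
  - by have [] := good a b a b (ltn_ord a) (ltn_ord b) c; rewrite ?leqnn ?leqnSn.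
  - by have [] := good a b a.+1 b (ltn_ord a) (ltn_ord b) c; rewrite ?leqnn ?leqnSn.
  - by have [] := good a b a b.+1 (ltn_ord a) (ltn_ord b) c; rewrite ?leqnn ?leqnSn.
  - by have [] := good a b a.+1 b.+1 (ltn_ord a) (ltn_ord b) c; rewrite ?leqnn ?leqnSn.
have split : \sum_(a < n) \sum_(b < n) (avoids (column_blocks s a) b)%:R *
    (contour e a b + 4%:R * 'i / n%:R) =
  \sum_(a < n) \sum_(b < n) (avoids (column_blocks s a) b)%:R * contour e a b +
  Gd%:R * (4%:R * 'i / n%:R).
  rewrite /Gd natr_sum mulr_suml -big_split /=; apply: eq_bigr => a _.
  rewrite natr_sum mulr_suml -big_split /=; apply: eq_bigr => b _.
  by rewrite mulrDr.
rewrite split in low.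
have tri := modulusD_le low up.
set T := \sum_(a < n) _ in low up split tri.
have := modulus_ler (Gd%:R * (4%:R * 'i / n%:R)) (- T).
rewrite opprK [_ + T]addrC modulusN => tri2.
have := le_trans tri2 (lerD up low).
rewrite !modulusM modulusV !modulus_nat modulus_i mulr1 => fin.
have fin2 : Gd%:R * 4 <= (17 / 8) * n%:R ^+ 2 + Gd%:R * (24 * K / n%:R) :> R.
  have := ler_wpM2l (ltW n0') fin.
  have -> : n%:R * (Gd%:R * (4 / n%:R)) = Gd%:R * 4 :> R by field; rewrite pnatr_eq0.
  have -> : n%:R * ((17 / 8) * n%:R + Gd%:R * (24 * K / n%:R ^+ 2)) =
    (17 / 8) * n%:R ^+ 2 + Gd%:R * (24 * K / n%:R) :> R by field; rewrite pnatr_eq0.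
  by [].
have small : 24 * K / n%:R <= 1 by rewrite ler_pdivrMr // mul1r; lra.
have := ler_wpM2l (ler0n R Gd) small.
have : 0 < n%:R ^+ 2 :> R by rewrite exprn_gt0.
lra.
Qed.

End Pixels.

(** * Compact sets and polynomials in several complex variables *)

Section Topology.
Variable R : realType.
Local Notation C := (cplx R).

Lemma modulus_cvgP (T : Type) (F : set_system T) (f : T -> C) (l : C) : Filter F ->
  (f @ F --> l) <-> (forall e : R, 0 < e -> \forall t \near F, modulus (l - f t) < e).
Proof.
move=> FF; split => [/cvgrPdist_lt h e e0|h].
  have := h (ofreal e); rewrite -[0 : C]/(ofreal 0) ofreal_lt => /(_ e0).
  by apply: filterS => t; rewrite modulusE ofreal_lt.
apply/cvgrPdist_lt => e e0.
have eR : 0 < complex.Re e by rewrite -ofreal_lt ofrealK // ltW.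
by apply: filterS (h _ eR) => t; rewrite lt_modulus // ltW.
Qed.

Lemma near_modulus (x : C) (e : R) : 0 < e -> \forall t \near x, modulus (x - t) < e.
Proof.
move=> e0; apply/nbhs_ballP; exists (ofreal e); first by rewrite /= -[0 : C]/(ofreal 0) ofreal_lt.
by move=> t; rewrite /ball /= modulusE ofreal_lt.
Qed.

Lemma modulus_continuous : continuous (@modulus R : C -> R).
Proof.
move=> x; apply: (iffRL (@cvgrPdist_lt _ _ _ _ (nbhs_filter x) _ _)) => e e0.
apply: filterS (near_modulus x e0) => t; apply: le_lt_trans.
by rewrite ler_norml; have := modulus_ler x t; have := modulus_ler t x;
  rewrite (modulusB t); lra.
Qed.

Lemma closed_modulus_le (T : topologicalType) (f : T -> C) (B : R) :
  continuous f -> closed [set x | modulus (f x) <= B].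
Proof.
move=> cf; have cmf : continuous (@modulus R \o f).
  by move=> x; apply: continuous_comp; [exact: cf|exact: modulus_continuous].
have /continuous_closedP h := cmf.
exact: (h [set r | r <= B] (@closed_le R B)).
Qed.

Lemma complex_of_pair_continuous :
  continuous (fun p : R * R => ofreal p.1 + 'i * ofreal p.2 : C).
Proof.
move=> [a b]; apply: (iffRL (modulus_cvgP _ _ (nbhs_filter (a, b)))) => e e0.
have e2 : 0 < e / 2 by lra.
have near_abs (c : R) : nbhs c [set x | `|c - x| < e / 2].
  by apply/nbhs_ballP; exists (e / 2).
exists ([set x | `|a - x| < e / 2], [set y | `|b - y| < e / 2]); first by split; exact: near_abs.
move=> [x y] [/= hx hy].
have -> : ofreal a + 'i * ofreal b - (ofreal x + 'i * ofreal y) =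
  ofreal (a - x) + 'i * ofreal (b - y).
  by rewrite !ofrealB; ring.
apply: le_lt_trans (modulusD _ _) _.
have -> : modulus ('i * ofreal (b - y)) = `|b - y|.
  by rewrite modulusM modulus_ofreal modulus_i mul1r.
by rewrite modulus_ofreal; lra.
Qed.

Lemma disk_compact (B : R) : compact [set x : C | modulus x <= B].
Proof.
pose A := (fun p : R * R => ofreal p.1 + 'i * ofreal p.2 : C) @` (`[- B, B] `*` `[- B, B]).
apply: (@subclosed_compact _ _ A).
- by apply: (@closed_modulus_le _ id) => x; exact: cvg_id.
- apply: continuous_compact; last by apply: compact_setX; exact: segment_compact.
  by apply: continuous_subspaceT; exact: complex_of_pair_continuous.
move=> x /= xB; exists (complex.Re x, complex.Im x) => /=.
  have := modulus_Re x; have := modulus_Im x.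
  by rewrite /= !in_itv /= !ler_norml => /andP[? ?] /andP[? ?]; split; apply/andP; split; lra.
by rewrite -ofreal_ReIm.
Qed.

(** Cantor's intersection theorem in a disc.  It gives both the completeness of the
    complex numbers and the passage from infinitely many holes to finitely many. *)
Lemma nested_nonempty (F : nat -> set C) (B : R) :
  (forall n, closed (F n)) -> (forall n p, (n <= p)%N -> F p `<=` F n) ->
  (forall n, F n !=set0) -> F 0%N `<=` [set x | modulus x <= B] ->
  exists x, forall n, F n x.
Proof.
move=> Fc Fd /choice[s hs] FB.
have inF n : (s @ \oo) (F n).
  by exists n => // p /= np; exact: Fd np _ (hs p).
have [|x [_ xcl]] := @disk_compact B (s @ \oo) _.
  by apply: filterS (inF 0%N); exact: FB.
exists x => n; apply: Fc => U /(xcl _ _ (inF n)); exact.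
Qed.

(** The limit of a Cauchy sequence, with the explicit error bounds that are used later:
    it lies in all the closed discs of radius [e n] around [S n]. *)
Lemma cauchy_limit (S : nat -> C) (e : nat -> R) :
  (forall n p, (n <= p)%N -> modulus (S p - S n) <= e n) ->
  exists l, forall n, modulus (l - S n) <= e n.
Proof.
move=> h; pose F n := [set x : C | forall k, (k <= n)%N -> modulus (x - S k) <= e k].
have [||||l hl] := @nested_nonempty F (e 0%N + modulus (S 0%N)).
- move=> n.
  have -> : F n = \bigcap_(k in [set k | (k <= n)%N]) [set x : C | modulus (x - S k) <= e k] by [].
  apply: closed_bigI => k _; apply: closed_modulus_le => x.
  apply: (iffRL (modulus_cvgP _ _ (nbhs_filter x))) => d d0.
  apply: filterS (near_modulus x d0) => t.
  by have -> : x - S k - (t - S k) = x - t by ring.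
- by move=> n p np x hx k kn; apply: hx; exact: leq_trans kn np.
- by move=> n; exists (S n) => k; exact: h.
- by move=> x /(_ 0%N (leqnn _)) /= hx; have := modulus_ler x (S 0%N); lra.
by exists l => n; exact: hl (leqnn _).
Qed.

Definition polydisc {n} (B : R) : set 'rV[C]_n := [set v | forall i, modulus (v ord0 i) <= B].

Lemma polydisc_compact n (B : R) :
  compact (polydisc B : set 'rV[C]_n).
Proof.
have := @rV_compact C n (fun=> [set x | modulus x <= B]) (fun=> @disk_compact B).
exact.
Qed.

Lemma continuous_const (T : topologicalType) (c : C) : continuous (fun _ : T => c).
Proof. by move=> x; exact: cvg_cst. Qed.

Lemma continuous_mul (T : topologicalType) (f g : T -> C) :
  continuous f -> continuous g -> continuous (fun x => f x * g x).
Proof. by move=> cf cg x; apply: cvgM; [exact: cf|exact: cg]. Qed.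

Lemma continuous_big_sum (T : topologicalType) (I : Type) (r : seq I) (F : I -> T -> C) :
  (forall i, continuous (F i)) -> continuous (fun x => \sum_(i <- r) F i x).
Proof.
move=> cF; elim: r => [|i r IH] x.
  under eq_fun do rewrite big_nil; exact: cvg_cst.
under eq_fun do rewrite big_cons; apply: cvgD; [exact: cF|exact: IH].
Qed.

Lemma continuous_big_prod (T : topologicalType) (I : Type) (r : seq I) (F : I -> T -> C) :
  (forall i, continuous (F i)) -> continuous (fun x => \prod_(i <- r) F i x).
Proof.
move=> cF; elim: r => [|i r IH] x.
  under eq_fun do rewrite big_nil; exact: cvg_cst.
under eq_fun do rewrite big_cons; apply: cvgM; [exact: cF|exact: IH].
Qed.

Lemma coordinate_continuous n (i : 'I_n) : continuous (fun v : 'rV[C]_n => v ord0 i).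
Proof. exact: (@coord_continuous C 1 n ord0 i). Qed.

Lemma peval_continuous n (p : mpoly.mpoly n C) : continuous (peval p).
Proof.
have -> : peval p = (fun z : 'rV[C]_n => \sum_(m <- mpoly.msupp p)
       mpoly.mcoeff m p * \prod_i z ord0 i ^+ (mpoly.fun_of_multinom m i)).
  by apply/funext => z; rewrite /peval mpoly.mevalE.
apply: continuous_big_sum => m; apply: continuous_mul; first exact: continuous_const.
apply: continuous_big_prod => i.
elim: (mpoly.fun_of_multinom m i) => [|k IH].
  under eq_fun do rewrite expr0; exact: continuous_const.
under eq_fun do rewrite exprS.
apply: continuous_mul; [exact: coordinate_continuous|exact: IH].
Qed.

End Topology.

Section Lipschitz.
Variables (R : realType) (n : nat) (B : R).
Local Notation C := (cplx R).

(** The distance is given by a common bound [D] on the coordinates, which avoids any norm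
    on the product. *)
Definition lipschitz_on (f : 'rV[C]_n -> C) := exists K : R, [/\ 0 <= K,
  forall v, polydisc B v -> modulus (f v) <= K &
  forall v v' (D : R), polydisc B v -> polydisc B v' -> 0 <= D ->
   (forall i, modulus (v ord0 i - v' ord0 i) <= D) -> modulus (f v - f v') <= K * D].

Lemma lipschitz_const c : lipschitz_on (fun=> c).
Proof.
exists (modulus c); split=> // v v' D _ _ D0 _.
by rewrite subrr modulus0 mulr_ge0.
Qed.

Lemma lipschitz_coord i : lipschitz_on (fun v => v ord0 i).
Proof.
exists (1 + `|B|); split=> [|v hv|v v' D _ _ D0 h]; first by rewrite addr_ge0.
  by have := hv i; have := ler_norm B; lra.
by have := h i; have := normr_ge0 B; nra.
Qed.

Lemma lipschitzD f h : lipschitz_on f -> lipschitz_on h -> lipschitz_on (fun v => f v + h v).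
Proof.
move=> [K [K0 hK1 hK2]] [L [L0 hL1 hL2]]; exists (K + L); split; first exact: addr_ge0.
  by move=> v hv; exact: modulusD_le (hK1 v hv) (hL1 v hv).
move=> v v' D hv hv' D0 hD.
have -> : f v + h v - (f v' + h v') = (f v - f v') + (h v - h v') by ring.
by rewrite mulrDl; exact: modulusD_le (hK2 v v' D hv hv' D0 hD) (hL2 v v' D hv hv' D0 hD).
Qed.

Lemma lipschitzM f h : lipschitz_on f -> lipschitz_on h -> lipschitz_on (fun v => f v * h v).
Proof.
move=> [K [K0 hK1 hK2]] [L [L0 hL1 hL2]].
have KL : 0 <= K * L by rewrite mulr_ge0.
exists (2 * (K * L)); split; first by lra.
  by move=> v hv; have := modulusM_le (hK1 v hv) (hL1 v hv); lra.
move=> v v' D hv hv' D0 hD.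
have -> : f v * h v - f v' * h v' = (f v - f v') * h v + f v' * (h v - h v') by ring.
apply: le_trans (modulusD_le (modulusM_le (hK2 v v' D hv hv' D0 hD) (hL1 v hv))
  (modulusM_le (hK1 v' hv') (hL2 v v' D hv hv' D0 hD))) _.
lra.
Qed.

Lemma lipschitz_sum (I : Type) (s : seq I) (F : I -> 'rV[C]_n -> C) :
  (forall i, lipschitz_on (F i)) -> lipschitz_on (fun v => \sum_(i <- s) F i v).
Proof.
move=> hF; elim: s => [|i s IH].
  by have := lipschitz_const 0; congr lipschitz_on; apply/funext => v; rewrite big_nil.
by have := lipschitzD (hF i) IH; congr lipschitz_on; apply/funext => v; rewrite big_cons.
Qed.

Lemma lipschitz_prod (I : Type) (s : seq I) (F : I -> 'rV[C]_n -> C) :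
  (forall i, lipschitz_on (F i)) -> lipschitz_on (fun v => \prod_(i <- s) F i v).
Proof.
move=> hF; elim: s => [|i s IH].
  by have := lipschitz_const 1; congr lipschitz_on; apply/funext => v; rewrite big_nil.
by have := lipschitzM (hF i) IH; congr lipschitz_on; apply/funext => v; rewrite big_cons.
Qed.

Lemma lipschitz_peval (p : mpoly.mpoly n C) : lipschitz_on (peval p).
Proof.
have -> : peval p = (fun z : 'rV[C]_n => \sum_(m <- mpoly.msupp p)
       mpoly.mcoeff m p * \prod_i z ord0 i ^+ (mpoly.fun_of_multinom m i)).
  by apply/funext => z; rewrite /peval mpoly.mevalE.
apply: lipschitz_sum => m; apply: lipschitzM; first exact: lipschitz_const.
apply: lipschitz_prod => i.
elim: (mpoly.fun_of_multinom m i) => [|k IH].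
  by have := lipschitz_const 1; congr lipschitz_on; apply/funext => v; rewrite expr0.
have := lipschitzM (lipschitz_coord i) IH; congr lipschitz_on.
by apply/funext => v; rewrite exprS.
Qed.

End Lipschitz.

(** * Uniform limits of polynomials and polynomial hulls *)

Section Approximation.
Variables (R : realType) (n : nat) (Y : set 'rV[cplx R]_n).
Local Notation C := (cplx R).

Definition approximable (f : 'rV[C]_n -> C) := forall e : R, 0 < e ->
  exists p : mpoly.mpoly n C, forall x, Y x -> modulus (f x - peval p x) <= e.

Lemma PX_approximable f : PX Y f <-> approximable f.
Proof.
split=> [h e e0|h U /uniform_nbhs[E [entE EU]]].
  have [|_ [[p _ <-] hp]] := h [set g | forall y, Y y -> modulus (f y - g y) < e].
    apply/uniform_nbhs; exists [set xy | ball xy.1 (ofreal e) xy.2]; split.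
      rewrite -entourage_ballE; exists (ofreal e) => //=.
      by rewrite -[0 : C]/(ofreal 0) ofreal_lt.
    by move=> g /= hg y /hg; rewrite /ball /= modulusE ofreal_lt.
  by exists p => x Yx; apply: ltW; exact: hp.
have [e e0 he] : exists2 e : C, 0 < e & [set xy | ball xy.1 e xy.2] `<=` E.
  by move: entE; rewrite -entourage_ballE.
have eR : 0 < complex.Re e by rewrite -ofreal_lt ofrealK // ltW.
have [|p hp] := h (complex.Re e / 2); first by rewrite divr_gt0.
exists (peval p); split; first by exists p.
apply: EU => y Yy; apply: he; rewrite /ball /= lt_modulus ?ltW //.
by apply: le_lt_trans (hp y Yy) _; lra.
Qed.

End Approximation.

Section Algebra.
Variables (R : realType) (n : nat).
Local Notation C := (cplx R).
Implicit Types (Y : set 'rV[C]_n) (f g : 'rV[C]_n -> C).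

Lemma peval_add (p q : mpoly.mpoly n C) :
  exists r, forall x, peval r x = peval p x + peval q x.
Proof. by eexists => x; exact: mpoly.mevalD. Qed.

Lemma peval_mul (p q : mpoly.mpoly n C) :
  exists r, forall x, peval r x = peval p x * peval q x.
Proof. by eexists => x; exact: mpoly.mevalM. Qed.

(** The only consequence of compactness that the algebra of uniform limits needs; unlike
    compactness it passes to the polynomial hull at once. *)
Definition poly_bounded Y := forall p : mpoly.mpoly n C, exists K : R,
  forall x, Y x -> modulus (peval p x) <= K.

Lemma approximable_const Y c : approximable Y (fun=> c).
Proof.
move=> e e0; exists (mpoly.mpolyC n c) => x _.
by rewrite /peval mpoly.mevalC subrr modulus0 ltW.
Qed.

Lemma approximable_coord Y (i : 'I_n) : approximable Y (fun x => x ord0 i).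
Proof.
move=> e e0; exists (mpoly.mpolyX C (mpoly.mnm1 i)) => x _.
by rewrite /peval mpoly.mevalXU subrr modulus0 ltW.
Qed.

Lemma approximable_bounded Y f : poly_bounded Y -> approximable Y f ->
  exists2 K : R, 0 <= K & forall x, Y x -> modulus (f x) <= K.
Proof.
move=> Yb /(_ 1 ltr01)[p hp]; have [K hK] := Yb p.
exists (1 + `|K|) => [|x Yx]; first by rewrite addr_ge0.
have := hp x Yx; have := hK x Yx; have := modulus_ler (f x) (peval p x).
have := ler_norm K; lra.
Qed.

Lemma approximableD Y f g : approximable Y f -> approximable Y g ->
  approximable Y (fun x => f x + g x).
Proof.
move=> hf hg e e0; have e2 : 0 < e / 2 by lra.
have [p hp] := hf _ e2; have [q hq] := hg _ e2.
have [r rE] := peval_add p q; exists r => x Yx; rewrite rE.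
have -> : f x + g x - (peval p x + peval q x) = (f x - peval p x) + (g x - peval q x) by ring.
by apply: le_trans (modulusD_le (hp x Yx) (hq x Yx)) _; lra.
Qed.

Lemma approximableM Y f g : poly_bounded Y -> approximable Y f -> approximable Y g ->
  approximable Y (fun x => f x * g x).
Proof.
move=> Yb hf hg e e0.
have [K K0 hK] := approximable_bounded Yb hf; have [L L0 hL] := approximable_bounded Yb hg.
set d := Num.min 1 (e / (K + L + 1)).
have kl : 0 < K + L + 1 by lra.
have d0 : 0 < d by rewrite lt_min ltr01 divr_gt0.
have d1 : d <= 1 by rewrite ge_min lexx.
have de : d * (K + L + 1) <= e by rewrite -ler_pdivlMr // ge_min lexx orbT.
have [p hp] := hf _ d0; have [q hq] := hg _ d0.
have [r rE] := peval_mul p q; exists r => x Yx; rewrite rE.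
have -> : f x * g x - peval p x * peval q x =
  f x * (g x - peval q x) + (f x - peval p x) * peval q x by ring.
have qL : modulus (peval q x) <= L + 1.
  have := modulus_ler (peval q x) (g x); rewrite (modulusB _ (g x)).
  have := hq x Yx; have := hL x Yx; lra.
apply: le_trans (modulusD_le (modulusM_le (hK x Yx) (hq x Yx))
  (modulusM_le (hp x Yx) qL)) _.
lra.
Qed.

Lemma approximableX Y f k : poly_bounded Y -> approximable Y f ->
  approximable Y (fun x => f x ^+ k).
Proof.
move=> Yb hf; elim: k => [|k IH]; first exact: approximable_const.
have := approximableM Yb hf IH; congr approximable; apply/funext => x.
by rewrite exprS.
Qed.

Lemma approximable_sum Y (F : nat -> 'rV[C]_n -> C) k :
  (forall j, approximable Y (F j)) -> approximable Y (fun x => \sum_(j < k) F j x).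
Proof.
move=> hF; elim: k => [|k IH].
  by have := approximable_const Y 0; congr approximable; apply/funext => x; rewrite big_ord0.
have := approximableD IH (hF k); congr approximable.
by apply/funext => x; rewrite big_ord_recr.
Qed.

Lemma approximable_limit Y f :
  (forall e : R, 0 < e -> exists g, approximable Y g /\
     forall x, Y x -> modulus (f x - g x) <= e) -> approximable Y f.
Proof.
move=> h e e0; have e2 : 0 < e / 2 by lra.
have [g [hg fg]] := h _ e2; have [p hp] := hg _ e2.
exists p => x Yx; apply: le_trans (modulusBD _ (g x) _) _.
have := hp x Yx; have := fg x Yx; lra.
Qed.

Lemma approximable_sub Y Y' f : Y' `<=` Y -> approximable Y f -> approximable Y' f.
Proof. by move=> YY' hf e /hf[p hp]; exists p => x /YY'; exact: hp. Qed.

Lemma sub_poly_hull Y : poly_bounded Y -> Y `<=` poly_hull Y.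
Proof.
move=> Yb x Yx p; have [K hK] := Yb p.
rewrite modulusE ofreal_le; apply: ub_le_sup; last by exists x.
by exists K => _ [y Yy <-]; exact: hK.
Qed.

Lemma sup_norm_le Y f (B : R) : 0 <= B -> (forall x, Y x -> modulus (f x) <= B) ->
  sup_norm Y f <= B.
Proof.
move=> B0 h; rewrite /sup_norm.
have [->|/set0P[x Yx]] := eqVneq Y set0; first by rewrite image_set0 sup0.
apply: ge_sup; first by exists (modulus (f x)), x.
by move=> _ [y Yy <-]; exact: h.
Qed.

(** Bounds on a set pass to its hull not only for polynomials but for their uniform
    limits on the hull. *)
Lemma poly_hull_le Y f (B : R) : approximable (poly_hull Y) f -> poly_bounded Y -> 0 <= B ->
  (forall x, Y x -> modulus (f x) <= B) ->
  forall y, poly_hull Y y -> modulus (f y) <= B.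
Proof.
move=> hf Yb B0 hB y Yy; apply/ler_addgt0Pr => e e0.
have e2 : 0 < e / 2 by lra.
have [p hp] := hf _ e2.
have : modulus (peval p y) <= B + e / 2.
  have := Yy p; rewrite modulusE ofreal_le => /le_trans; apply.
  apply: sup_norm_le; first by lra.
  move=> x Yx; have := hp x (sub_poly_hull Yb Yx).
  have := modulus_ler (peval p x) (f x); rewrite (modulusB _ (f x)).
  by have := hB x Yx; lra.
by have := hp y Yy; have := modulus_ler (f y) (peval p y); lra.
Qed.

Lemma poly_bounded_hull Y : poly_bounded Y -> poly_bounded (poly_hull Y).
Proof.
move=> Yb p; exists (sup_norm Y (peval p)) => y /(_ p).
by rewrite modulusE ofreal_le.
Qed.

Lemma poly_hull_closed Y : closed (poly_hull Y).
Proof.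
have -> : poly_hull Y = \bigcap_(p in [set: mpoly.mpoly n C])
    [set z | modulus (peval p z) <= sup_norm Y (peval p)].
  apply/seteqP; split=> z hz p; first by move=> _; have := hz p; rewrite modulusE ofreal_le.
  by rewrite modulusE ofreal_le; exact: hz.
by apply: closed_bigI => p _; apply: closed_modulus_le; exact: peval_continuous.
Qed.

End Algebra.

(** * The set X in two variables *)

Section Surface.
Variable R : realType.
Local Notation C := (cplx R).
Variables (center : nat -> C) (radius : nat -> R) (rexp pexp : nat -> nat).
Hypothesis radius_gt0 : forall k, 0 < radius k.

Let m k := (2 ^ rexp k)%N.
Let m_gt0 k : (0 < m k)%N. Proof. by rewrite expn_gt0. Qed.

Definition coord_z (x : 'rV[C]_2) : C := x ord0 ord0.
Definition coord_w (x : 'rV[C]_2) : C := x ord0 ord_max.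

(** Its zeros are the poles of the localizing function 1 / g_k, whose root of order
    [2 ^ rexp k] is adjoined. *)
Definition pole_poly k (z : C) : C :=
  1 + ((z - center k) / ofreal (radius k)) ^+ (2 ^ pexp k).

Definition pole_bound k : R :=
  1 + ((2 + modulus (center k)) / radius k) ^+ (2 ^ pexp k).

Lemma pole_bound_ge1 k : 1 <= pole_bound k.
Proof.
rewrite lerDl exprn_ge0 // divr_ge0 //; [exact: addr_ge0|exact: ltW].
Qed.

Lemma pole_polyP k z : modulus z <= 2 -> modulus (pole_poly k z) <= pole_bound k.
Proof.
move=> z2; apply: le_trans (modulusD _ _) _; rewrite modulus1 lerD2l modulusX.
apply: lerXn2r; rewrite ?nnegrE //.
  by apply: divr_ge0; [exact: addr_ge0|exact: ltW].
rewrite modulusM modulusV modulus_ofreal gtr0_norm // ler_pM2r ?invr_gt0 //.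
by apply: le_trans (modulusD _ _) _; rewrite modulusN lerD2r.
Qed.

Lemma tame_pole_poly (E : C -> Prop) k : (forall z, E z -> modulus z <= 2) -> tame E (pole_poly k).
Proof.
move=> E2; apply: tameD; first exact: tame_const.
apply: tameX; apply: tameM; last exact: tame_const.
by apply: tameD; [exact: (@tame_id _ _ 2)|exact: tame_const].
Qed.

(** The roots stay away from 0 and hence from each other, which is why they can be
    recovered from approximate values. *)
Lemma root_modulus_ge k z u : modulus z <= 2 -> pole_poly k z * u ^+ m k = 1 ->
  (pole_bound k)^-1 <= modulus u.
Proof.
move=> z2 gu; have G1 := pole_bound_ge1 k; have G0 : 0 < pole_bound k by lra.
rewrite leNgt; apply/negP => us.
have : modulus (pole_poly k z) * modulus u ^+ m k = 1 by rewrite -modulusX -modulusM gu modulus1.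
have u1 : modulus u <= 1 by apply: ltW; apply: lt_le_trans us _; rewrite invf_le1.
have : modulus u ^+ m k <= modulus u.
  by rewrite -(prednK (m_gt0 k)) exprS ler_piMr // exprn_ile1.
move=> h1 h2.
have := ler_pM (modulus_ge0 _) (exprn_ge0 _ (modulus_ge0 _)) (pole_polyP k z2) h1.
rewrite h2.
have : pole_bound k * modulus u < 1 by rewrite mulrC -ltr_pdivlMr // div1r.
lra.
Qed.

(** An error of this size on the k-th root is harmless: divided by the least modulus of
    the root it is a relative error within the Newton radius, and the factor
    m + 3^m keeps the residual |g v^m - 1| small as well. *)
Definition tolerance k : R :=
  newton_radius R (m k) / ((m k)%:R + 3 ^+ m k) / pole_bound k.

(** Everything after the k-th term of the series for w adds up to at most
    [4 * weight k.+1], that is [weight k * tolerance k]. *)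
Fixpoint weight k : R := if k is j.+1 then weight j * (tolerance j / 4) else 1.

Let denom k : R := (m k)%:R + 3 ^+ m k.
Let denom_ge1 k : 1 <= denom k.
Proof.
have : 1 <= 3 ^+ m k :> R by rewrite exprn_ege1 //; lra.
by have : 0 <= (m k)%:R :> R by []; rewrite /denom; lra.
Qed.

Lemma tolerance_gt0 k : 0 < tolerance k.
Proof.
have := denom_ge1 k; have := pole_bound_ge1 k => h1 h2.
rewrite /tolerance -/(denom k) !divr_gt0 //; last by lra.
  exact: newton_radius_gt0.
lra.
Qed.

Lemma tolerance_le1 k : tolerance k <= 1.
Proof.
have d1 := denom_ge1 k; have p1 := pole_bound_ge1 k.
have n0 := newton_radius_gt0 R (m k); have n1 := newton_radius_le R (m k).
rewrite /tolerance -/(denom k) !ler_pdivrMr; try lra.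
nra.
Qed.

Lemma weight_gt0 k : 0 < weight k.
Proof. by elim: k => [|k IH] //=; rewrite mulr_gt0 // divr_gt0 // tolerance_gt0. Qed.

Lemma weight_quarter k : weight k.+1 <= weight k / 4.
Proof. by rewrite /= ler_pM2l ?weight_gt0 //; have := tolerance_le1 k; lra. Qed.

Lemma weight_le k : weight k <= (1 / 4) ^+ k.
Proof.
elim: k => [|k IH]; first by rewrite expr0.
by rewrite exprS; have := weight_quarter k; lra.
Qed.

(** Unique when it exists, by [newton_unique]; the default value 0 only occurs off the
    polynomial hull of X. *)
Definition nearby_root k (g v : C) : C :=
  xget 0 [set u | g * u ^+ m k = 1 /\ modulus (v - u) <= newton_radius R (m k) * modulus u].

Lemma nearby_rootP k g v u : g * u ^+ m k = 1 ->
  modulus (v - u) <= newton_radius R (m k) * modulus u -> nearby_root k g v = u.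
Proof.
move=> gu vu; rewrite /nearby_root; case: xgetP => [u' _ [gu' vu']|/(_ u) []//].
exact: newton_unique gu' gu vu' vu.
Qed.

Lemma nearby_root_spec k g v u : g * u ^+ m k = 1 ->
  modulus (v - u) <= newton_radius R (m k) * modulus u ->
  g * nearby_root k g v ^+ m k = 1 /\
  modulus (v - nearby_root k g v) <= newton_radius R (m k) * modulus (nearby_root k g v).
Proof. by move=> gu vu; rewrite (nearby_rootP gu vu). Qed.

(** The roots are read off from a point (z, w) one after the other, and
    [sheet_sum k] is the partial sum of w made of the roots already found.  Defining them
    as functions on the whole plane C^2 makes sense of them on the hull. *)
Fixpoint sheet_sum k (x : 'rV[C]_2) : C :=
  if k is j.+1 then
    sheet_sum j x + ofreal (weight j) *
      nearby_root j (pole_poly j (coord_z x)) ((coord_w x - sheet_sum j x) / ofreal (weight j))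
  else 0.

Definition approx_sheet k x : C := (coord_w x - sheet_sum k x) / ofreal (weight k).
Definition sheet k x : C := nearby_root k (pole_poly k (coord_z x)) (approx_sheet k x).

Lemma sheet_sumS k x : sheet_sum k.+1 x = sheet_sum k x + ofreal (weight k) * sheet k x.
Proof. by []. Qed.

(** The image of the set of all (z, u_0, u_1, ...) under w = sum_k c_k u_k, described
    through the roots read off from (z, w).  The last inequality replaces the convergence
    of the series. *)
Definition surface : set 'rV[C]_2 := [set x | modulus (coord_z x) <= 2 /\
  forall k, [/\ pole_poly k (coord_z x) * sheet k x ^+ m k = 1, modulus (sheet k x) <= 2 &
                modulus (coord_w x - sheet_sum k x) <= 4 * weight k]].

Let oweight0 k : ofreal (weight k) != 0.
Proof. by rewrite -modulus_gt0 modulus_ofreal normr_gt0 lt0r_neq0 // weight_gt0. Qed.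

(** The approximate value v of the k-th root, when w agrees with the partial sum up to
    the size of the remaining terms. *)
Lemma approx_sheet_near k z (v w S u : C) : modulus z <= 2 -> pole_poly k z * u ^+ m k = 1 ->
  modulus (w - (S + ofreal (weight k) * u)) <= 4 * weight k.+1 ->
  v = (w - S) / ofreal (weight k) ->
  modulus (v / u - 1) * denom k <= newton_radius R (m k) /\ u != 0.
Proof.
move=> z2 gu hw ->; have wk := weight_gt0 k.
have ge := root_modulus_ge z2 gu.
have G1 := pole_bound_ge1 k; have d1 := denom_ge1 k.
have u0 : u != 0.
  by rewrite -modulus_gt0; apply: lt_le_trans ge; rewrite invr_gt0; lra.
split=> //.
have -> : (w - S) / ofreal (weight k) / u - 1 = (w - (S + ofreal (weight k) * u)) / ofreal (weight k) / u.
  by field; rewrite u0 oweight0.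
rewrite 2!modulusM !modulusV modulus_ofreal (gtr0_norm wk).
have h1 : modulus (w - (S + ofreal (weight k) * u)) / weight k <= tolerance k.
  by rewrite ler_pdivrMr //; move: hw => /=; lra.
have h2 : (modulus u)^-1 <= pole_bound k.
  by rewrite -[pole_bound k]invrK lef_pV2 // posrE ?modulus_gt0 // invr_gt0; lra.
have h3 : tolerance k * pole_bound k = newton_radius R (m k) / denom k.
  by rewrite /tolerance -/(denom k) divfK // lt0r_neq0 //; lra.
have h4 : modulus (w - (S + ofreal (weight k) * u)) / weight k / modulus u <= newton_radius R (m k) / denom k.
  by rewrite -h3; apply: ler_pM => //; rewrite ?divr_ge0 ?invr_ge0 // ltW.
by rewrite -ler_pdivlMr //; lra.
Qed.

Lemma approx_sheet_radius k z (v w S u : C) : modulus z <= 2 -> pole_poly k z * u ^+ m k = 1 ->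
  modulus (w - (S + ofreal (weight k) * u)) <= 4 * weight k.+1 ->
  v = (w - S) / ofreal (weight k) ->
  modulus (v - u) <= newton_radius R (m k) * modulus u.
Proof.
move=> z2 gu hw vE; have [h u0] := approx_sheet_near z2 gu hw vE.
have -> : v - u = (v / u - 1) * u by field.
rewrite modulusM; apply: ler_wpM2r => //.
by apply: le_trans h; rewrite ler_peMr // denom_ge1.
Qed.

Lemma approx_sheet_residual k z (v w S u : C) : modulus z <= 2 -> pole_poly k z * u ^+ m k = 1 ->
  modulus (w - (S + ofreal (weight k) * u)) <= 4 * weight k.+1 ->
  v = (w - S) / ofreal (weight k) ->
  modulus (pole_poly k z * v ^+ m k - 1) <= newton_residual R (m k).
Proof.
move=> z2 gu hw vE; have [h u0] := approx_sheet_near z2 gu hw vE.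
have d1 := denom_ge1 k; have nr := newton_radius_le R (m k).
set t := v / u - 1 in h.
have t1 : modulus t <= 1.
  have : modulus t <= modulus t * denom k by rewrite ler_peMr.
  lra.
have -> : pole_poly k z * v ^+ m k = (1 + t) ^+ m k.
  have -> : v = u * (1 + t) by rewrite /t; field.
  by rewrite exprMn mulrA gu mul1r.
apply: le_trans (expr_lip _ t1) _; rewrite mulrC.
apply: le_trans h _; exact: newton_residual_ge.
Qed.

(** Any sequence of roots that adds up to w is the one read off from (z, w). *)
Lemma sheet_unique x (u : nat -> C) : modulus (coord_z x) <= 2 ->
  (forall k, pole_poly k (coord_z x) * u k ^+ m k = 1) ->
  (forall k, modulus (coord_w x - \sum_(i < k) ofreal (weight i) * u i) <= 4 * weight k) ->
  forall k, sheet_sum k x = \sum_(i < k) ofreal (weight i) * u i /\ sheet k x = u k.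
Proof.
move=> z2 gu hw.
have E k : sheet_sum k x = \sum_(i < k) ofreal (weight i) * u i -> sheet k x = u k.
  move=> pE; apply: nearby_rootP => //.
  apply: (approx_sheet_radius (w := coord_w x) (S := sheet_sum k x) z2 (gu k)) => //.
  by rewrite pE; have := hw k.+1; rewrite big_ord_recr.
elim=> [|k [IH1 IH2]].
  have p0 : sheet_sum 0 x = \sum_(i < 0) ofreal (weight i) * u i by rewrite big_ord0.
  by split=> //; exact: E.
have p1 : sheet_sum k.+1 x = \sum_(i < k.+1) ofreal (weight i) * u i.
  by rewrite sheet_sumS big_ord_recr /= IH1 IH2.
by split=> //; exact: E.
Qed.

Lemma surface_intro x (u : nat -> C) : modulus (coord_z x) <= 2 ->
  (forall k, pole_poly k (coord_z x) * u k ^+ m k = 1) -> (forall k, modulus (u k) <= 2) ->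
  (forall k, modulus (coord_w x - \sum_(i < k) ofreal (weight i) * u i) <= 4 * weight k) ->
  surface x.
Proof.
move=> z2 gu u2 hw; split=> // k.
by have [-> ->] := sheet_unique z2 gu hw k.
Qed.

Lemma surface_polydisc : surface `<=` polydisc 4.
Proof.
move=> x [z2 hx] i.
have [->|->] : i = ord0 \/ i = ord_max.
  by case: i => -[|[|//]] ?; [left|right]; apply/val_inj.
- by rewrite -/(coord_z x); lra.
- by have [_ _] := hx 0%N; rewrite /= subr0 mulr1.
Qed.

Lemma surface_poly_bounded : poly_bounded surface.
Proof.
move=> p; have [K [_ hK _]] := lipschitz_peval 4 p.
by exists K => x /surface_polydisc; exact: hK.
Qed.

Local Notation Y := (poly_hull surface).
Let Yb : poly_bounded Y := poly_bounded_hull surface_poly_bounded.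

Lemma approximable_pole Z k : poly_bounded Z -> approximable Z (fun x => pole_poly k (coord_z x)).
Proof.
move=> Zb; apply: approximableD; first exact: approximable_const.
apply: approximableX => //; apply: approximableM => //; last exact: approximable_const.
by apply: approximableD; [exact: approximable_coord|exact: approximable_const].
Qed.

Lemma hull_z y : Y y -> modulus (coord_z y) <= 2.
Proof.
apply: (@poly_hull_le _ _ _ coord_z) => //; first exact: approximable_coord.
  exact: surface_poly_bounded.
by move=> x [].
Qed.

Lemma approximable_newton f k t : approximable Y f ->
  approximable Y (fun x => iter t (newton (m k) (pole_poly k (coord_z x))) (f x)).
Proof.
move=> hf; elim: t => [|t IH] //=.
rewrite /newton; apply: approximableD => //; apply: approximableM => //; last exact: approximable_const.
apply: approximableM => //; apply: approximableD; first exact: approximable_const.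
have -> : (fun x => - (pole_poly k (coord_z x) *
    iter t (newton (m k) (pole_poly k (coord_z x))) (f x) ^+ m k)) =
   (fun x => (-1) * (pole_poly k (coord_z x) *
    iter t (newton (m k) (pole_poly k (coord_z x))) (f x) ^+ m k)).
  by apply/funext => x; rewrite mulN1r.
apply: approximableM => //; first exact: approximable_const.
by apply: approximableM => //; [exact: approximable_pole|exact: approximableX].
Qed.

(** The heart of polynomial convexity.  The residual of the approximate root is small on
    X, hence on the hull; so the approximate root is near an exact root at each point of
    the hull, and the Newton iterates, which are uniform limits of polynomials, converge
    uniformly to this root. *)
Lemma hull_sheet k : approximable Y (sheet_sum k) ->
  approximable Y (sheet k) /\
  forall y, Y y -> pole_poly k (coord_z y) * sheet k y ^+ m k = 1.
Proof.
move=> hp.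
have hv : approximable Y (approx_sheet k).
  apply: approximableM => //; last exact: approximable_const.
  apply: approximableD; first exact: approximable_coord.
  have -> : (fun x => - sheet_sum k x) = (fun x => (-1) * sheet_sum k x).
    by apply/funext => x; rewrite mulN1r.
  by apply: approximableM => //; exact: approximable_const.
have r0 := newton_radius_gt0 R (m k); have r1 := newton_radius_le R (m k).
have res y : Y y -> modulus (pole_poly k (coord_z y) * approx_sheet k y ^+ m k - 1) <= newton_residual R (m k).
  apply: (@poly_hull_le _ _ _ (fun y => pole_poly k (coord_z y) * approx_sheet k y ^+ m k - 1)).
  - apply: approximableD; last exact: approximable_const.
    by apply: approximableM => //; [exact: approximable_pole|exact: approximableX].
  - exact: surface_poly_bounded.
  - by apply: le_trans (newton_residual_ge R (m_gt0 k)); exact: ltW.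
  (* on X the root is within the tolerance, by the condition of index k + 1 *)
  - move=> x [z2 hx]; have [gu _ _] := hx k; have [_ _] := hx k.+1; rewrite sheet_sumS => hw.
    exact: approx_sheet_residual z2 gu hw erefl.
have spec y : Y y -> pole_poly k (coord_z y) * sheet k y ^+ m k = 1 /\
    modulus (approx_sheet k y - sheet k y) <= newton_radius R (m k) * modulus (sheet k y).
  move=> /res /newton_exists[u gu vu]; exact: nearby_root_spec gu vu.
split=> [|y /spec[]//].
have [K K0 hK] := approximable_bounded Yb hv.
apply: approximable_limit => e e0.
have [t ht] : exists t, (2 * K + 1) * (1 / 2) ^+ t < e.
  have [||t ht] := @expr_small R (1 / 2) (e / (2 * K + 1)); first by lra.
    by rewrite divr_gt0 //; lra.
  by exists t; rewrite mulrC -ltr_pdivlMr //; lra.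
exists (fun x => iter t (newton (m k) (pole_poly k (coord_z x))) (approx_sheet k x)); split.
  exact: approximable_newton.
move=> y Yy; have [gu vu] := spec y Yy.
rewrite modulusB; apply: le_trans (newton_iter t (m_gt0 k) gu vu) _.
apply: le_trans (ltW ht); apply: ler_wpM2r; first by rewrite exprn_ge0 //; lra.
have := modulus_ler (sheet k y) (approx_sheet k y); rewrite (modulusB (sheet k y)).
have := hK y Yy; have := modulus_ge0 (sheet k y); nra.
Qed.

Lemma hull_sheet_sum k : approximable Y (sheet_sum k).
Proof.
elim: k => [|k IH]; first exact: approximable_const.
have [h _] := hull_sheet IH; apply: approximableD => //.
by apply: approximableM => //; exact: approximable_const.
Qed.

(** All the conditions defining X are bounds on uniform limits of polynomials, and hold on
    the hull as well. *)
Lemma surface_poly_convex : poly_convex surface.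
Proof.
apply/seteqP; split; last exact: sub_poly_hull surface_poly_bounded.
move=> y Yy; split=> [|k]; first exact: hull_z.
have [hs gs] := hull_sheet (hull_sheet_sum k).
split; first exact: gs.
- apply: (@poly_hull_le _ _ _ (sheet k)) Yy => //; first exact: surface_poly_bounded.
  by move=> x [_ /(_ k)[]].
- apply: (@poly_hull_le _ _ _ (fun y => coord_w y - sheet_sum k y)) Yy => //.
  + apply: approximableD; first exact: approximable_coord.
    have -> : (fun x => - sheet_sum k x) = (fun x => (-1) * sheet_sum k x).
      by apply/funext => x; rewrite mulN1r.
    by apply: approximableM; [exact: Yb|exact: approximable_const|exact: hull_sheet_sum].
  + exact: surface_poly_bounded.
  + by rewrite mulr_ge0 // ltW // weight_gt0.
  + by move=> x [_ /(_ k)[]].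
Qed.

Lemma surface_sheet_approximable k : approximable surface (sheet k).
Proof.
apply: approximable_sub (proj1 (hull_sheet (hull_sheet_sum k))).
exact: sub_poly_hull surface_poly_bounded.
Qed.

Lemma surface_compact : compact surface.
Proof.
apply: (subclosed_compact _ (@polydisc_compact R 2 4) surface_polydisc).
rewrite -surface_poly_convex; exact: poly_hull_closed.
Qed.

End Surface.

(** * Peak points *)

Section PeakSeries.
Variable R : realType.
Local Notation C := (cplx R).

Let lam : R := 15 / 16.
Definition peak_weight (n : nat) : R := lam ^+ n.

Lemma peak_weight_gt0 n : 0 < peak_weight n.
Proof. by rewrite exprn_gt0 // /lam; lra. Qed.

Lemma peak_weight_le1 n : peak_weight n <= 1.
Proof. by rewrite exprn_ile1 // /lam; lra. Qed.

Lemma peak_weightS n : peak_weight n.+1 = 15 / 16 * peak_weight n.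
Proof. by rewrite /peak_weight exprS. Qed.

Definition weighted (a : nat -> R) (n : nat) : R :=
  \sum_(j < n) (1 / 16) * peak_weight j * a j.

Lemma weightedS a n : weighted a n.+1 = weighted a n + 1 / 16 * peak_weight n * a n.
Proof. by rewrite /weighted big_ord_recr. Qed.

Lemma weighted_le a (B : R) n p : (n <= p)%N ->
  (forall j, (n <= j < p)%N -> a j <= B) ->
  weighted a p <= weighted a n + B * (peak_weight n - peak_weight p).
Proof.
move=> /subnKC <-; elim: (p - n)%N => [|d IH] h; first by rewrite addn0; lra.
have hB : a (n + d)%N <= B by apply: h; rewrite leq_addr addnS ltnSn.
have {}IH : weighted a (n + d) <= weighted a n + B * (peak_weight n - peak_weight (n + d)).
  by apply: IH => j /andP[h1 h2]; apply: h; rewrite h1 addnS ltnS ltnW.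
rewrite addnS weightedS peak_weightS.
have := ler_wpM2l (ltW (peak_weight_gt0 (n + d))) hB; lra.
Qed.

(** Bishop's construction.  [D] is the distance to the fibre of [x0], and [q n] is small
    where [D >= rho n].  A point with [D y > 0] enters the small region at some index n:
    the earlier terms are at most 1 + lam^n / 16, one term may be as large as 6, and the
    later ones are at most 1 / 8.  The weights lam^j / 16 with lam = 15 / 16 are chosen so
    that one term of size 6 costs less than the remaining mass lam^n. *)
Variables (T : Type) (q : nat -> T -> C) (D : T -> R) (rho : nat -> R) (x0 : T) (X : T -> Prop).

Definition peak_psum (n : nat) (y : T) : C := \sum_(j < n) ofreal (1 / 16 * peak_weight j) * q j y.

Lemma modulus_peak_psum n y : modulus (peak_psum n y) <= weighted (fun j => modulus (q j y)) n.
Proof.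
apply: le_trans (modulus_sum _ _ _) _; apply: ler_sum => j _.
rewrite modulusM modulus_ofreal ger0_norm // mulr_ge0 //; last exact/ltW/peak_weight_gt0.
by lra.
Qed.

Hypothesis rho_le : forall n, rho n <= n.+1%:R^-1.
Hypothesis q_x0 : forall n, q n x0 = 1.
Hypothesis q_bound : forall n y, X y -> modulus (q n y) <= 6.
Hypothesis q_far : forall n y, X y -> rho n <= D y -> modulus (q n y) <= 1 / 8.
Hypothesis q_near : forall n j y, X y -> (j < n)%N -> D y < rho n ->
  modulus (q j y) <= 1 + peak_weight n / 16.
Hypothesis q_fibre : forall y, X y -> y <> x0 -> D y <= 0 ->
  (forall n, modulus (q n y) <= 1) /\ exists n, modulus (q n y) < 1.

Lemma peak_psum_cauchy y n p : X y -> (n <= p)%N ->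
  modulus (peak_psum p y - peak_psum n y) <= 6 * peak_weight n.
Proof.
move=> Xy np.
have : modulus (peak_psum p y - peak_psum n y) <= 6 * (peak_weight n - peak_weight p).
  rewrite -(subnKC np); elim: (p - n)%N => [|d IH].
    by rewrite addn0 !subrr modulus0 mulr0.
  rewrite addnS /peak_psum big_ord_recr /= -/(peak_psum _ _) addrAC peak_weightS.
  have w0 := peak_weight_gt0 (n + d).
  have h : modulus (ofreal (1 / 16 * peak_weight (n + d)) * q (n + d) y) <=
     1 / 16 * peak_weight (n + d) * 6.
    apply: modulusM_le (q_bound _ Xy).
    by rewrite modulus_ofreal ger0_norm // mulr_ge0 // ?ltW //; lra.
  by apply: le_trans (modulusD_le IH h) _; lra.
by have := peak_weight_gt0 p; lra.
Qed.

(** The bound is uniform in the number of terms, so that it remains strict in the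
    limit. *)
Lemma peak_psum_gap y : X y -> y <> x0 -> exists (n0 : nat) (gap : R),
  0 < gap /\ forall p, (n0 <= p)%N -> modulus (peak_psum p y) <= 1 - gap.
Proof.
move=> Xy yx; have w0 n := peak_weight_gt0 n; have w1 n := peak_weight_le1 n.
have base : weighted (fun j => modulus (q j y)) 0 = 0 by rewrite /weighted big_ord0.
have pw0 : peak_weight 0 = 1 by rewrite /peak_weight expr0.
have [D0|Dp] := leP (D y) 0.
  have [le1 [n hn]] := q_fibre Xy yx D0.
  (* on the fibre no term exceeds 1 and one of them is smaller *)
  exists n.+1, (1 / 16 * peak_weight n * (1 - modulus (q n y))); split.
    by rewrite !mulr_gt0 // ?subr_gt0 //; lra.
  move=> p np; apply: le_trans (modulus_peak_psum _ _) _.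
  have h1 := @weighted_le (fun j => modulus (q j y)) 1 0 n (leq0n n) (fun j _ => le1 j).
  have h2 := @weighted_le (fun j => modulus (q j y)) 1 n.+1 p np (fun j _ => le1 j).
  rewrite weightedS peak_weightS in h2; rewrite base pw0 in h1.
  have := w0 p; lra.
have [m0 hm0] : exists m, forall j, (m <= j)%N -> rho j <= D y.
  exists (Num.truncn (D y)^-1) => j mj; apply: le_trans (rho_le j) _.
  rewrite -[D y]invrK lef_pV2 ?posrE ?invr_gt0 ?ltr0n //.
  by apply: ltW; apply: lt_le_trans (truncnS_gt _) _; rewrite ler_nat.
have exm : exists m, `[< forall j, (m <= j)%N -> rho j <= D y >].
  by exists m0; apply/asboolP.
case: (ex_minnP exm) => -[|n] /asboolP hn hmin.
  exists 0%N, (7 / 8); split; first by lra.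
  move=> p _; apply: le_trans (modulus_peak_psum _ _) _.
  have := @weighted_le (fun j => modulus (q j y)) (1 / 8) 0 p (leq0n p)
    (fun j _ => q_far Xy (hn j (leq0n j))).
  by rewrite base pw0; have := w0 p; lra.
have Dn : D y < rho n.
  rewrite ltNge; apply/negP => hle.
  suff /hmin : `[< forall j, (n <= j)%N -> rho j <= D y >] by rewrite ltnn.
  by apply/asboolP => j; rewrite leq_eqVlt => /orP[/eqP <-|/hn].
exists n.+1, (7 / 16 * peak_weight n); split.
  by rewrite mulr_gt0 //; lra.
move=> p np; apply: le_trans (modulus_peak_psum _ _) _.
have h1 := @weighted_le (fun j => modulus (q j y)) (1 + peak_weight n / 16) 0 n (leq0n n)
    (fun j hj => q_near Xy (proj2 (andP hj)) Dn).
have h2 := @weighted_le (fun j => modulus (q j y)) 6 n n.+1 (leqnSn n) (fun j _ => q_bound j Xy).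
have h3 := @weighted_le (fun j => modulus (q j y)) (1 / 8) n.+1 p np
   (fun j hj => q_far Xy (hn j (proj1 (andP hj)))).
rewrite base pw0 in h1; rewrite peak_weightS in h2 h3.
have := w0 p; have := w0 n; have := w1 n; nra.
Qed.

Lemma peak_psum_x0 n : peak_psum n x0 = ofreal (1 - peak_weight n).
Proof.
elim: n => [|n IH]; first by rewrite /peak_psum big_ord0 /peak_weight expr0 subrr.
rewrite /peak_psum big_ord_recr /= -/(peak_psum _ _) IH q_x0 mulr1 -ofrealD peak_weightS.
by congr ofreal; lra.
Qed.

Lemma peak_series : X x0 -> exists F : T -> C,
  [/\ forall n y, X y -> modulus (F y - peak_psum n y) <= 6 * peak_weight n,
      F x0 = 1 & forall y, X y -> y <> x0 -> modulus (F y) < 1].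
Proof.
move=> Xx0.
have /choice[F hF] : forall y, exists l, X y -> forall n,
    modulus (l - peak_psum n y) <= 6 * peak_weight n.
  move=> y; have [Xy|nXy] := pselect (X y); last by exists 0.
  have [|l hl] := @cauchy_limit R (fun n => peak_psum n y) (fun n => 6 * peak_weight n).
    by move=> n p; exact: peak_psum_cauchy.
  by exists l.
exists F; split; first by move=> n y /hF; apply.
  apply/eqP; rewrite -subr_eq0 -modulus_eq0 eq_le modulus_ge0 andbT.
  apply: (@le0_of_geometric _ _ 7 lam); first by rewrite /lam; lra.
  move=> n; have := hF x0 Xx0 n; rewrite peak_psum_x0 => h.
  have := modulusBD (F x0) (ofreal (1 - peak_weight n)) 1.
  have -> : ofreal (1 - peak_weight n) - 1 = ofreal (- peak_weight n).
    by rewrite (_ : 1 = ofreal 1 :> C) // -ofrealB; congr ofreal; lra.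
  rewrite modulus_ofreal normrN (gtr0_norm (peak_weight_gt0 n)) -/(peak_weight n); lra.
move=> y Xy yx; have [n0 [gap [gap0 hgap]]] := peak_psum_gap Xy yx.
have [||k hk] := @expr_small R lam (gap / 6); rewrite /lam ?divr_gt0 //; first by lra.
have h1 := hgap _ (leq_addr k n0); have h2 := hF y Xy (n0 + k)%N.
have := modulus_ler (F y) (peak_psum (n0 + k) y).
have : peak_weight (n0 + k) <= peak_weight k.
  by rewrite /peak_weight exprD ler_piMl // ?peak_weight_le1 // ltW // peak_weight_gt0.
by rewrite {2}/peak_weight /lam; lra.
Qed.
End PeakSeries.

(** The three hypotheses on the discs: they shrink to every point of the disc |z| <= 2,
    each g_k is so small in the middle of its disc that its root is at least 1 / 2 there,
    and so large outside twice the disc that the root is at most 1 / (k + 1). *)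
Section Peak.
Variable R : realType.
Local Notation C := (cplx R).
Variables (center : nat -> C) (radius : nat -> R) (rexp pexp : nat -> nat).
Hypothesis radius_gt0 : forall k, 0 < radius k.
Let m k := (2 ^ rexp k)%N.
Let m_gt0 k : (0 < m k)%N. Proof. by rewrite expn_gt0. Qed.
Local Notation g := (pole_poly center radius pexp).
Local Notation u := (sheet center radius rexp pexp).
Local Notation X := (surface center radius rexp pexp).

Hypothesis cover : forall (z : C) (e : R) (N : nat), modulus z <= 2 -> 0 < e ->
  exists k, [/\ (N <= k)%N, modulus (z - center k) <= radius k / 2 & 5 / 2 * radius k <= e].
Hypothesis pole_near : forall k z, modulus (z - center k) <= radius k / 2 ->
  modulus (g k z) <= 3 / 2.
Hypothesis pole_far : forall k z, 2 * radius k <= modulus (z - center k) ->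
  k.+1%:R ^+ m k <= modulus (g k z).

Lemma sheet_modulus x k : X x -> modulus (g k (coord_z x)) * modulus (u k x) ^+ m k = 1.
Proof. by move=> [_ /(_ k)[h _ _]]; rewrite -modulusX -modulusM h modulus1. Qed.

Lemma sheet_neq0 x k : X x -> 0 < modulus (u k x).
Proof.
move=> /(sheet_modulus k) h; rewrite lt_def modulus_ge0 andbT; apply: contra_eq_neq h => ->.
by rewrite expr0n gtn_eqF //= mulr0 eq_sym oner_eq0.
Qed.

(** A disc of large index and small radius around z(x): the bound 1 / (k + 1) on the root
    outside makes it smaller than any prescribed 1 / M. *)
Lemma localizing_sheet x (e M : R) : X x -> 0 < e -> exists k, 1 / 2 <= modulus (u k x) /\
  forall y, X y -> e <= modulus (coord_z y - coord_z x) -> M * modulus (u k y) <= 1.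
Proof.
move=> Xx e0; have z2 : modulus (coord_z x) <= 2 by case: Xx.
have [k [Nk near rk]] := cover (Num.truncn M) z2 e0.
have r0 := radius_gt0 k.
exists k; split.
  rewrite leNgt; apply/negP => h.
  have := sheet_modulus k Xx; have := pole_near near.
  have : modulus (u k x) ^+ m k <= modulus (u k x).
    by rewrite -(prednK (m_gt0 k)) exprS ler_piMr // exprn_ile1 //; lra.
  have := exprn_ge0 (m k) (modulus_ge0 (u k x)); have := modulus_ge0 (g k (coord_z x)); nra.
move=> y Xy yx.
have far : 2 * radius k <= modulus (coord_z y - center k).
  have := modulusBD (coord_z y) (center k) (coord_z x); rewrite (modulusB (center k)); lra.
have Mk : M <= k.+1%:R.
  by apply: ltW; apply: lt_le_trans (truncnS_gt M) _; rewrite ler_nat ltnS.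
have h : (k.+1%:R * modulus (u k y)) ^+ m k <= 1.
  rewrite exprMn -[leRHS](sheet_modulus k Xy); apply: ler_wpM2r; first exact: exprn_ge0.
  exact: pole_far.
have h' : k.+1%:R * modulus (u k y) <= 1.
  rewrite leNgt; apply/negP => h1; move: h; rewrite leNgt => /negP; apply.
  by rewrite exprn_egt1 // -lt0n.
by apply: le_trans h'; exact: ler_wpM2r.
Qed.

Lemma sheet_fibre x y k : X x -> X y -> coord_z y = coord_z x -> modulus (u k y) = modulus (u k x).
Proof.
move=> Xx Xy zz; have := sheet_modulus k Xx; have := sheet_modulus k Xy; rewrite zz => h1 h2.
have g0 : modulus (g k (coord_z x)) != 0.
  by apply: contra_eq_neq h1 => ->; rewrite mul0r eq_sym oner_eq0.
apply: (pexpIrn (m_gt0 k)); rewrite ?nnegrE //.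
by apply: (mulfI g0); rewrite h1 h2.
Qed.

(** Only an upper bound is needed near x, and it holds for all determinations of the root
    at once. *)
Lemma sheet_semicontinuous x k (e : R) : X x -> 0 < e -> exists2 d : R, 0 < d &
  forall y, X y -> modulus (coord_z y - coord_z x) < d -> modulus (u k y) <= (1 + e) * modulus (u k x).
Proof.
move=> Xx e0.
have [h1 [K [K0 _ hK]]] : tame (fun z => modulus z <= 2) (g k).
  exact: tame_pole_poly.
have z2 : modulus (coord_z x) <= 2 by case: Xx.
set G := modulus (g k (coord_z x)); have gx := sheet_modulus k Xx; rewrite -/G in gx.
have um0 : 0 < modulus (u k x) ^+ m k by rewrite exprn_gt0 // sheet_neq0.
have G0 : 0 < G.
  rewrite lt_def modulus_ge0 andbT; apply: contra_eq_neq gx => ->.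
  by rewrite mul0r eq_sym oner_eq0.
exists (G * (e / (1 + e)) / (K + 1)).
  by rewrite !mulr_gt0 // ?invr_gt0; lra.
move=> y Xy; rewrite ltr_pdivlMr; last by lra.
move=> yx; have y2 : modulus (coord_z y) <= 2 by case: Xy.
have [lip _] := hK _ _ z2 y2.
have gy := sheet_modulus k Xy.
have G1 : G * (1 + e)^-1 <= modulus (g k (coord_z y)).
  have : modulus (g k (coord_z y) - g k (coord_z x)) <= G * (e / (1 + e)).
    by apply: le_trans lip _; have := modulus_ge0 (coord_z y - coord_z x); lra.
  have := modulus_ler (g k (coord_z x)) (g k (coord_z y)); rewrite -/G (modulusB (g k (coord_z x))).
  have -> : e / (1 + e) = 1 - (1 + e)^-1 by field; rewrite gt_eqF //; lra.
  by lra.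
rewrite leNgt; apply/negP => hlt.
have ux := sheet_neq0 k Xx.
have : (1 + e) * modulus (u k x) ^+ m k < modulus (u k y) ^+ m k.
  apply: (@le_lt_trans _ _ (((1 + e) * modulus (u k x)) ^+ m k)).
    rewrite exprMn ler_pM2r // -(prednK (m_gt0 k)) exprS ler_peMr //; first by lra.
    by rewrite exprn_ege1 //; lra.
  by rewrite ltrXn2r // ?nnegrE ?mulr_ge0 //; [rewrite -lt0n|lra].
move=> h3.
have h4 : 1 < G * (1 + e)^-1 * modulus (u k y) ^+ m k.
  rewrite mulrAC ltr_pdivlMr ?mul1r; last by lra.
  have : G * ((1 + e) * modulus (u k x) ^+ m k) < G * modulus (u k y) ^+ m k by rewrite ltr_pM2l.
  by rewrite mulrCA gx mulr1.
have := ler_wpM2r (exprn_ge0 (m k) (modulus_ge0 (u k y))) G1; lra.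
Qed.

Lemma sheets_semicontinuous x N (e : R) : X x -> 0 < e -> exists2 d : R, 0 < d &
  forall k y, (k < N)%N -> X y -> modulus (coord_z y - coord_z x) < d ->
    modulus (u k y) <= (1 + e) * modulus (u k x).
Proof.
move=> Xx e0; elim: N => [|N [d d0 hd]]; first by exists 1.
have [d' d'0 hd'] := sheet_semicontinuous N Xx e0.
exists (Num.min d d') => [|k y]; first by rewrite lt_min d0.
rewrite ltnS leq_eqVlt lt_min => /orP[/eqP ->|kN] Xy /andP[h1 h2]; first exact: hd'.
exact: hd.
Qed.

(** The roots determine w. *)
Lemma surface_separated x y : X x -> X y -> coord_z y = coord_z x -> y <> x ->
  exists k, u k y <> u k x.
Proof.
move=> [_ hx] [_ hy] zz yx; apply: contrapT => /forallNP h; apply: yx.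
have uu k : u k y = u k x by apply: contrapT; exact: h.
have ps k : sheet_sum center radius rexp pexp k y = sheet_sum center radius rexp pexp k x.
  by elim: k => [|k IH] //; rewrite !sheet_sumS IH uu.
have ww : coord_w y = coord_w x.
  apply/eqP; rewrite -subr_eq0 -modulus_eq0 eq_le modulus_ge0 andbT.
  apply: (@le0_of_geometric _ _ 8 (1 / 4)); first by lra.
  move=> k; have [_ _ h1] := hx k; have [_ _ h2] := hy k; rewrite ps in h2.
  have := modulusBD (coord_w y) (sheet_sum center radius rexp pexp k x) (coord_w x).
  rewrite (modulusB (sheet_sum _ _ _ _ _ _) (coord_w x)).
  have := weight_le center rexp pexp radius_gt0 k; lra.
apply/rowP => -[[|[|//]] hi].
  by move: zz; rewrite /coord_z; congr (_ = _); congr (_ _ _); apply: val_inj.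
by move: ww; rewrite /coord_w; congr (_ = _); congr (_ _ _); apply: val_inj.
Qed.

(** The n-th function is a localizing root times (1 + u_n / u_n(x)) / 2, so that every root
    gets its turn in separating the fibre.  Its disc is chosen so small that all the
    functions chosen before are at most 1 + lam^n / 16 there: this only depends on the
    largest index used so far, which is the state [N] of the recursion. *)
Lemma surface_peak_point x : X x -> peak_point X (PX X) x.
Proof.
move=> Xx; split=> //.
pose eps n := peak_weight R n / 32.
have eps0 n : 0 < eps n by rewrite divr_gt0 ?peak_weight_gt0.
have eps1 n : eps n <= 1 by have := peak_weight_le1 R n; rewrite /eps; lra.
pose q k l y := u k y / u k x * ((1 + u l y / u l x) / 2%:R).
have /choice[sel hsel] : forall nN : nat * nat, exists kd : nat * R,
    [/\ kd.2 <= nN.1.+1%:R^-1, 1 / 2 <= modulus (u kd.1 x),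
     forall k y, (k < maxn nN.2 nN.1.+1)%N -> X y -> modulus (coord_z y - coord_z x) < kd.2 ->
       modulus (u k y) <= (1 + eps nN.1) * modulus (u k x),
     forall y, X y -> kd.2 <= modulus (coord_z y - coord_z x) ->
       modulus (q kd.1 nN.1 y) <= 1 / 8 & 0 < kd.2].
  move=> -[n N] /=.
  have [d d0 hd] := sheets_semicontinuous (maxn N n.+1) Xx (eps0 n).
  set d' := Num.min d n.+1%:R^-1.
  have d'0 : 0 < d' by rewrite lt_min d0 invr_gt0 ltr0n.
  set B := (1 + 2 / modulus (u n x)) / 2.
  have un0 := sheet_neq0 n Xx.
  have [k [k1 k2]] := localizing_sheet (16 * B) Xx d'0.
  exists (k, d'); split=> //=.
  - by rewrite ge_min lexx orbT.
  - by move=> j y jN Xy; rewrite lt_min => /andP[h1 _]; exact: hd.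
  move=> y Xy yx; have hk := k2 y Xy yx.
  have hB : modulus ((1 + u n y / u n x) / 2%:R) <= B.
    rewrite modulusM modulusV modulus_nat; apply: ler_wpM2r; first by rewrite invr_ge0.
    apply: le_trans (modulusD _ _) _; rewrite modulus1 lerD2l modulusM modulusV.
    by apply: ler_wpM2r; [rewrite invr_ge0|have [_ /(_ n)[]] := Xy].
  have hu : modulus (u k y / u k x) <= 2 * modulus (u k y).
    rewrite modulusM modulusV mulrC; apply: ler_wpM2r => //.
    by rewrite -[2]invrK lef_pV2 ?posrE ?invr_gt0 //; lra.
  by apply: le_trans (modulusM_le hu hB) _; lra.
pose N := fix N n := if n is n'.+1 then maxn (N n') (sel (n', N n')).1.+1 else 0%N.
pose kk n := (sel (n, N n)).1; pose rho n := (sel (n, N n)).2.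
have Nmono i j : (i < j)%N -> (kk i < N j)%N.
  elim: j => [//|j IH]; rewrite ltnS leq_eqVlt => /orP[/eqP ->|/IH h] /=.
    by rewrite leq_max ltnSn orbT.
  by rewrite leq_max h.
have ratio k y (a : R) : X y -> modulus (u k y) <= a * modulus (u k x) ->
    modulus (u k y / u k x) <= a.
  by move=> Xy h; rewrite modulusM modulusV ler_pdivrMr // sheet_neq0.
have half l y (a : R) : modulus (u l y / u l x) <= a ->
    modulus ((1 + u l y / u l x) / 2%:R) <= (1 + a) / 2.
  move=> h; rewrite modulusM modulusV modulus_nat; apply: ler_wpM2r; first by rewrite invr_ge0.
  by apply: le_trans (modulusD _ _) _; rewrite modulus1 lerD2l.
have [F [F1 F2 F3]] : exists F : 'rV[C]_2 -> C,
  [/\ forall n y, X y -> modulus (F y - peak_psum (fun n => q (kk n) n) n y) <= 6 * peak_weight R n,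
      F x = 1 & forall y, X y -> y <> x -> modulus (F y) < 1].
  apply: (@peak_series R _ (fun n => q (kk n) n) (fun y => modulus (coord_z y - coord_z x)) rho x X) => //.
  - by move=> n; have [] := hsel (n, N n).
  - move=> n; have un := sheet_neq0 n Xx; have uk := sheet_neq0 (kk n) Xx.
    rewrite modulus_gt0 in un; rewrite modulus_gt0 in uk.
    by rewrite /q (divff uk) (divff un) mul1r -mulr2n divff // pnatr_eq0.
  - move=> n y Xy; have [_ k1 near far _] := hsel (n, N n).
    have [/(far _ Xy)|lt] := leP (rho n) (modulus (coord_z y - coord_z x)); first by rewrite /kk /=; lra.
    have h1 : modulus (u (kk n) y / u (kk n) x) <= 4.
      by apply: ratio => //; have [_ /(_ (kk n))[_ h _]] := Xy; rewrite -/(kk n) in k1; lra.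
    have h2 : modulus (u n y / u n x) <= 1 + eps n.
      by apply: ratio => //; apply: near => //=; rewrite leq_max ltnSn orbT.
    apply: le_trans (modulusM_le h1 (half _ _ _ h2)) _; have := eps1 n; lra.
  - by move=> n y Xy; have [_ _ _ far _] := hsel (n, N n); exact: far.
  - move=> n j y Xy jn lt; have [_ _ near _ _] := hsel (n, N n).
    have h1 : modulus (u (kk j) y / u (kk j) x) <= 1 + eps n.
      by apply: ratio => //; apply: near => //=; rewrite leq_max (Nmono _ _ jn).
    have h2 : modulus (u j y / u j x) <= 1 + eps n.
      by apply: ratio => //; apply: near => //=; rewrite leq_max ltnS (ltnW jn) orbT.
    apply: le_trans (modulusM_le h1 (half _ _ _ h2)) _.
    have := eps1 n; have := eps0 n.
    have -> : peak_weight R n / 16 = 2 * eps n by rewrite /eps; lra.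
    nra.
  - move=> y Xy yx; rewrite le_eqVlt ltNge modulus_ge0 orbF modulus_eq0 subr_eq0 => /eqP zz.
    have eqm k : modulus (u k y / u k x) = 1.
      by rewrite modulusM modulusV (sheet_fibre k Xx Xy zz) divff // lt0r_neq0 // sheet_neq0.
    split=> [n|].
      have := modulusM_le (lexx (modulus (u (kk n) y / u (kk n) x))) (half n y _ (lexx _)).
      by rewrite !eqm => h; apply: le_trans h _; lra.
    have [l ul] := surface_separated Xx Xy zz yx; exists l.
    rewrite /q modulusM eqm mul1r modulusM modulusV modulus_nat ltr_pdivrMr // mul1r.
    have ux0 : u l x != 0 by rewrite -modulus_gt0 sheet_neq0.
    set t := u l y / u l x; have t1 : modulus t = 1 := eqm l.
    have tn1 : t <> 1.
      by move=> t1'; apply: ul; rewrite -[LHS](divfK ux0) -/t t1' mul1r.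
    exact: modulus_add1_lt2.
exists F; split=> //.
- apply/PX_approximable; apply: approximable_limit => e e0.
  have [||n hn] := @expr_small R (15 / 16) (e / 6); rewrite ?divr_gt0 //; first by lra.
  exists (peak_psum (fun n => q (kk n) n) n); split.
    have Xb : poly_bounded X := surface_poly_bounded _ _ _ _.
    apply: (@approximable_sum _ _ _ (fun j y => ofreal (1 / 16 * peak_weight R j) * q (kk j) j y)) => j.
    apply: approximableM => //; first exact: approximable_const.
    have us k : approximable X (u k) := surface_sheet_approximable _ _ _ radius_gt0 k.
    have ur k : approximable X (fun y => u k y / u k x).
      by apply: approximableM => //; exact: approximable_const.
    apply: approximableM => //; apply: approximableM => //; last exact: approximable_const.
    by apply: approximableD => //; exact: approximable_const.
  move=> y Xy; apply: le_trans (F1 n y Xy) _; rewrite /peak_weight; lra.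
- by move=> y Xy yx; rewrite modulusE -[1]/(ofreal 1) ofreal_lt; exact: F3.
Qed.
End Peak.

(** * Polynomials are not dense on X *)

Section NonDensity.
Variable R : realType.
Local Notation C := (cplx R).
Variables (center : nat -> C) (radius : nat -> R) (rexp pexp : nat -> nat).
Hypothesis radius_gt0 : forall k, 0 < radius k.
Let m k := (2 ^ rexp k)%N.
Let m_gt0 k : (0 < m k)%N. Proof. by rewrite expn_gt0. Qed.
Local Notation g := (pole_poly center radius pexp).
Local Notation weight := (weight center radius rexp pexp).
Local Notation X := (surface center radius rexp pexp).

(** Polynomials in z, the first [N] roots and the first [M] functions 1 / g_k.  The roots
    are independent variables here, so that they can be averaged one at a time. *)
Inductive ratfun (N M : nat) : (C -> (nat -> C) -> C) -> Prop :=
| ratfun_const c : ratfun N M (fun _ _ => c)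
| ratfun_z : ratfun N M (fun z _ => z)
| ratfun_root k : (k < N)%N -> ratfun N M (fun _ u => u k)
| ratfun_pole k : (k < M)%N -> ratfun N M (fun z _ => (g k z)^-1)
| ratfun_add f h : ratfun N M f -> ratfun N M h -> ratfun N M (fun z u => f z u + h z u)
| ratfun_mul f h : ratfun N M f -> ratfun N M h -> ratfun N M (fun z u => f z u * h z u).

Lemma ratfun_exp N M f k : ratfun N M f -> ratfun N M (fun z u => f z u ^+ k).
Proof.
move=> hf; elim: k => [|k IH]; first exact: ratfun_const.
have := ratfun_mul hf IH; congr ratfun.
by apply/funext => z; apply/funext => u; rewrite exprS.
Qed.

Lemma ratfun_sum N M (I : Type) (s : seq I) (F : I -> C -> (nat -> C) -> C) :
  (forall i, ratfun N M (F i)) -> ratfun N M (fun z u => \sum_(i <- s) F i z u).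
Proof.
move=> hF; elim: s => [|i s IH].
  have := ratfun_const N M 0; congr ratfun.
  by apply/funext => z; apply/funext => u; rewrite big_nil.
have := ratfun_add (hF i) IH; congr ratfun.
by apply/funext => z; apply/funext => u; rewrite big_cons.
Qed.

Lemma ratfun_prod N M (I : Type) (s : seq I) (F : I -> C -> (nat -> C) -> C) :
  (forall i, ratfun N M (F i)) -> ratfun N M (fun z u => \prod_(i <- s) F i z u).
Proof.
move=> hF; elim: s => [|i s IH].
  have := ratfun_const N M 1; congr ratfun.
  by apply/funext => z; apply/funext => u; rewrite big_nil.
have := ratfun_mul (hF i) IH; congr ratfun.
by apply/funext => z; apply/funext => u; rewrite big_cons.
Qed.

Lemma ratfun_ext N M f z u u' : ratfun N M f -> (forall k, (k < N)%N -> u k = u' k) ->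
  f z u = f z u'.
Proof.
move=> hf uu; elim: hf => {f} [//|//|k kN|//|f h _ -> _ ->|f h _ -> _ ->] //; exact: uu.
Qed.

Definition update (u : nat -> C) (N : nat) (v : C) (k : nat) : C := if k == N then v else u k.

(** The list stands for the sum of its terms [t.1 * u_N ^ t.2]. *)
Definition in_class N M (s : seq ((C -> (nat -> C) -> C) * nat)) :=
  List.Forall (fun t => ratfun N M t.1) s.

Lemma ratfun_expand N M f : ratfun N.+1 M f -> exists s, in_class N M s /\
  forall z u, f z u = \sum_(t <- s) t.1 z u * u N ^+ t.2.
Proof.
elim=> {f} [c||k|k kM|f h _ [s [cs hs]] _ [t [ct ht]]|f h _ [s [cs hs]] _ [t [ct ht]]].
- exists [:: (fun _ _ => c, 0%N)]; split; first by constructor; [exact: ratfun_const|constructor].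
  by move=> z u; rewrite big_seq1 expr0 mulr1.
- exists [:: (fun z _ => z, 0%N)]; split; first by constructor; [exact: ratfun_z|constructor].
  by move=> z u; rewrite big_seq1 expr0 mulr1.
- rewrite ltnS leq_eqVlt => /orP[/eqP ->|kN].
    exists [:: (fun _ _ => 1, 1%N)]; split; first by constructor; [exact: ratfun_const|constructor].
    by move=> z u; rewrite big_seq1 expr1 mul1r.
  exists [:: (fun _ u => u k, 0%N)]; split; first by constructor; [exact: ratfun_root|constructor].
  by move=> z u; rewrite big_seq1 expr0 mulr1.
- exists [:: (fun z _ => (g k z)^-1, 0%N)]; split; first by constructor; [exact: ratfun_pole|constructor].
  by move=> z u; rewrite big_seq1 expr0 mulr1.
- exists (s ++ t); split; first by apply/List.Forall_app.
  by move=> z u; rewrite big_cat /= hs ht.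
- exists [seq (fun z u => a.1 z u * b.1 z u, (a.2 + b.2)%N) | a <- s, b <- t]; split.
    elim: cs => [|a s' ha _ IH]; first by constructor.
    rewrite /= /in_class; apply/List.Forall_app; split=> //.
    elim: ct => [|b t' hb _ IH']; first by constructor.
    by constructor=> //; exact: ratfun_mul.
  move=> z u; rewrite hs ht big_allpairs_dep mulr_suml; apply: eq_bigr => a _.
  rewrite mulr_sumr; apply: eq_bigr => b _ /=.
  by rewrite exprD mulrACA.
Qed.

(** The average over the values of the last root no longer depends on it, and remains
    within [e] of any constant that was within [e] of all the values. *)
Lemma ratfun_average N M f : (N < M)%N -> ratfun N.+1 M f -> exists2 f', ratfun N M f' &
  forall z u c (e : R), g N z != 0 ->
   (forall v, g N z * v ^+ m N = 1 -> modulus (f z (update u N v) - c) <= e) ->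
   modulus (f' z u - c) <= e.
Proof.
move=> NM /ratfun_expand[s [cs fE]].
exists (fun z u => \sum_(t <- s | (m N %| t.2)%N) t.1 z u * (g N z)^-1 ^+ (t.2 %/ m N)).
  elim: cs {fE} => [|t s' ht _ IH].
    have := ratfun_const N M 0; congr ratfun.
    by apply/funext => z; apply/funext => u; rewrite big_nil.
  have [d|/negbTE nd] := boolP (m N %| t.2)%N.
    have := ratfun_add (ratfun_mul ht (ratfun_exp (t.2 %/ m N) (ratfun_pole N NM))) IH.
    by congr ratfun; apply/funext => z; apply/funext => u; rewrite big_cons d.
  by have := IH; congr ratfun; apply/funext => z; apply/funext => u; rewrite big_cons nd.
move=> z u c e g0 h.
pose s' := [seq (t.1 z u, t.2) | t <- s].
have := @root_average R (rexp N) s' (g N z)^-1 c e; rewrite big_map; apply => v hv.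
have := h v; rewrite hv mulfV // => /(_ erefl); rewrite fE big_map.
rewrite {2}/update eqxx.
suff -> : \sum_(t <- s) t.1 z (update u N v) * v ^+ t.2 = \sum_(t <- s) t.1 z u * v ^+ t.2 by [].
elim: cs {fE s' h} => [|t s' ht _ IH]; first by rewrite !big_nil.
rewrite !big_cons IH; congr (_ * _ + _); apply: ratfun_ext ht _ => k kN.
by rewrite /update ltn_eqF.
Qed.

Lemma ratfun_average_all N M f : (N <= M)%N -> ratfun N M f -> exists2 f', ratfun 0 M f' &
  forall z c (e : R), (forall k, (k < N)%N -> g k z != 0) ->
   (forall u, (forall k, (k < N)%N -> g k z * u k ^+ m k = 1) -> modulus (f z u - c) <= e) ->
   modulus (f' z (fun=> 0) - c) <= e.
Proof.
elim: N f => [|N IH] f NM hf; first by exists f => // z c e _; apply.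
have [f1 hf1 f1E] := ratfun_average NM hf.
have [f2 hf2 f2E] := IH f1 (ltnW NM) hf1.
exists f2 => // z c e g0 h; apply: f2E => [k kN|u hu]; first by apply: g0; exact: ltnW.
apply: f1E => [|v hv]; first exact: g0.
apply: h => k; rewrite ltnS leq_eqVlt /update => /orP[/eqP ->|kN]; first by rewrite eqxx.
by rewrite ltn_eqF //; exact: hu.
Qed.

(** The projection of X to the z-plane is the intersection of these sets: the inequality
    says that the k-th roots have modulus at most 2. *)
Definition cheese M (z : C) : Prop := modulus z <= 2 /\
  forall k, (k < M)%N -> (2 ^+ m k)^-1 <= modulus (g k z).

Lemma cheese_pole_neq0 M z k : cheese M z -> (k < M)%N -> g k z != 0.
Proof.
move=> [_ h] kM; rewrite -modulus_gt0; apply: lt_le_trans (h k kM).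
by rewrite invr_gt0 exprn_gt0.
Qed.

Lemma ratfun_tame N M f u : ratfun N M f -> tame (cheese M) (fun z => f z u).
Proof.
elim=> {f} [c||k _|k kM|f h _ hf _ hh|f h _ hf _ hh].
- exact: tame_const.
- by apply: (@tame_id _ _ 2) => z [].
- exact: tame_const.
- apply: (@tameV _ _ _ (2 ^+ m k)^-1); first by rewrite invr_gt0 exprn_gt0.
    by move=> z [_]; apply.
  by apply: tame_pole_poly => z [].
- exact: tameD.
- exact: tameM.
Qed.

Lemma closed_modulus_ge (E : C -> Prop) (f : C -> C) (K B : R) : 0 <= K ->
  (forall p q, E p -> E q -> modulus (f q - f p) <= K * modulus (q - p)) ->
  closed (E : set C) -> closed [set z | E z /\ B <= modulus (f z)].
Proof.
move=> K0 hK cE z zcl.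
have Ez : E z.
  by apply: cE => U /zcl[w [[Ew _] Uw]]; exists w.
split=> //; apply/ler_addgt0Pr => e e0.
have K1 : 0 < K + 1 by lra.
have [w [[/= Ew Bw] zw]] := zcl _ (near_modulus z (divr_gt0 e0 K1)).
rewrite /= ltr_pdivlMr // in zw.
have lip := hK w z Ew Ez.
have := modulus_ler (f w) (f z); rewrite (modulusB (f w)).
have := modulus_ge0 (z - w); lra.
Qed.

Lemma cheese_closed M : closed (cheese M : set C).
Proof.
elim: M => [|M IH].
  have -> : cheese 0 = [set z : C | modulus z <= 2].
    by apply/seteqP; split=> z; [case|split].
  by apply: (@closed_modulus_le R C id) => x; exact: cvg_id.
have -> : cheese M.+1 = [set z | cheese M z /\ (2 ^+ m M)^-1 <= modulus (g M z)].
  apply/seteqP; split=> z /=.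
    by move=> [z2 h]; split; [split=> // k kM; apply: h; exact: ltnW|exact: h].
  move=> [[z2 h] hM]; split=> // k; rewrite ltnS leq_eqVlt => /orP[/eqP ->//|]; exact: h.
have [|h1 [K [K0 _ hK]]] := @tame_pole_poly R center radius pexp (cheese M) M; first by move=> z [].
by apply: (@closed_modulus_ge (cheese M) (g M) K) => // p q Ep Eq; have [] := hK p q Ep Eq.
Qed.

Lemma root_exists k z : g k z != 0 -> exists v, g k z * v ^+ m k = 1.
Proof.
move=> g0; have [v hv] := pow2_root_exists (rexp k) (g k z)^-1.
by exists v; rewrite hv mulfV.
Qed.

Lemma root_le2 k z v : (2 ^+ m k)^-1 <= modulus (g k z) -> g k z * v ^+ m k = 1 -> modulus v <= 2.
Proof.
move=> hg gv; rewrite leNgt; apply/negP => v2.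
have h : modulus (g k z) * modulus v ^+ m k = 1 by rewrite -modulusX -modulusM gv modulus1.
have : 2 ^+ m k < modulus v ^+ m k by rewrite ltrXn2r ?nnegrE // -lt0n.
have p0 : 0 < 2 ^+ m k :> R by rewrite exprn_gt0.
move=> h2; have : 1 < modulus (g k z) * modulus v ^+ m k.
  apply: (@le_lt_trans _ _ ((2 ^+ m k)^-1 * 2 ^+ m k)); first by rewrite mulVf // lt0r_neq0.
  apply: (@le_lt_trans _ _ (modulus (g k z) * 2 ^+ m k)); first by rewrite ler_pM2r.
  rewrite ltr_pM2l //; apply: lt_le_trans hg; by rewrite invr_gt0.
by rewrite h ltxx.
Qed.

Lemma partial_sum_cauchy (u : nat -> C) n p : (forall k, modulus (u k) <= 2) -> (n <= p)%N ->
  modulus (\sum_(i < p) ofreal (weight i) * u i - \sum_(i < n) ofreal (weight i) * u i) <= 4 * weight n.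
Proof.
move=> u2 np; have w0 k : 0 < weight k := weight_gt0 _ _ _ radius_gt0 k.
suff : modulus (\sum_(i < p) ofreal (weight i) * u i - \sum_(i < n) ofreal (weight i) * u i)
   <= 4 * weight n - 4 * weight p by have := w0 p; lra.
rewrite -(subnKC np); elim: (p - n)%N => [|d IH]; first by rewrite addn0 !subrr modulus0.
rewrite addnS big_ord_recr /= addrAC.
have h : modulus (ofreal (weight (n + d)) * u (n + d)%N) <= weight (n + d) * 2.
  by apply: modulusM_le => //; rewrite modulus_ofreal gtr0_norm.
apply: le_trans (modulusD_le IH h) _.
have := weight_quarter center rexp pexp radius_gt0 (n + d); have := w0 (n + d)%N.
by rewrite /=; lra.
Qed.

Definition point (z w : C) : 'rV[C]_2 := \row_i (if i == ord0 then z else w).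

Lemma coord_z_point z w : coord_z (point z w) = z. Proof. by rewrite /coord_z mxE. Qed.
Lemma coord_w_point z w : coord_w (point z w) = w. Proof. by rewrite /coord_w mxE. Qed.

(** Over a point of all the cheeses every choice of the roots occurs in X; this is what
    makes the averages meaningful. *)
Lemma surface_above z (u : nat -> C) : (forall M, cheese M z) ->
  (forall k, g k z * u k ^+ m k = 1) -> exists2 w, X (point z w) &
  forall k, modulus (w - \sum_(i < k) ofreal (weight i) * u i) <= 4 * weight k.
Proof.
move=> hz gu.
have u2 k : modulus (u k) <= 2.
  by have [_ h] := hz k.+1; apply: root_le2 (h k (ltnSn k)) (gu k).
have [w hw] := @cauchy_limit R (fun n => \sum_(i < n) ofreal (weight i) * u i) (fun n => 4 * weight n)
  (fun n p => @partial_sum_cauchy u n p u2).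
exists w => //; apply: (@surface_intro R center radius rexp pexp radius_gt0 _ u);
  rewrite ?coord_z_point ?coord_w_point //.
by have [] := hz 0%N.
Qed.

Lemma ratfun_sheet_sum N M : ratfun N M (fun _ u => \sum_(i < N) ofreal (weight i) * u i).
Proof.
suff h K : (K <= N)%N -> ratfun N M (fun _ u => \sum_(i < K) ofreal (weight i) * u i).
  exact: h (leqnn N).
elim: K => [|K IH] KN.
  have := ratfun_const N M 0; congr ratfun.
  by apply/funext => z; apply/funext => u; rewrite big_ord0.
have := ratfun_add (IH (ltnW KN)) (ratfun_mul (ratfun_const _ _ (ofreal (weight K))) (ratfun_root M KN)).
congr ratfun; apply/funext => z; apply/funext => u; by rewrite big_ord_recr.
Qed.

Lemma ratfun_peval N M (p : mpoly.mpoly 2 C) :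
  ratfun N M (fun z u => peval p (point z (\sum_(i < N) ofreal (weight i) * u i))).
Proof.
have -> : (fun z (u : nat -> C) => peval p (point z (\sum_(i < N) ofreal (weight i) * u i))) =
   (fun z u => \sum_(a <- mpoly.msupp p) mpoly.mcoeff a p *
      \prod_i (if i == ord0 then z else \sum_(i < N) ofreal (weight i) * u i)
         ^+ (mpoly.fun_of_multinom a i)).
  apply/funext => z; apply/funext => u; rewrite /peval mpoly.mevalE.
  by apply: eq_bigr => a _; congr (_ * _); apply: eq_bigr => i _; rewrite mxE.
apply: ratfun_sum => a; apply: ratfun_mul; first exact: ratfun_const.
apply: ratfun_prod => i; apply: ratfun_exp.
case: (i == ord0); [exact: ratfun_z|exact: ratfun_sheet_sum].
Qed.

Hypothesis radius_le1 : forall k, radius k <= 1.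
Hypothesis rexp_ge : forall k, (k + 8 <= 2 ^ rexp k)%N.

(** In the variable (z - a_k) / r_k, the set |g_k| < 2^-m is covered by discs of this radius
    around the n-th roots of -1, n = 2 ^ pexp k; their total radius 2 * 2^-m does not
    depend on n. *)
Definition hole_radius k : R := 2 / 2 ^+ m k / (2 ^ pexp k)%:R.

Definition holes_at k : seq (C * R) :=
  [seq (center k + ofreal (radius k) * w, radius k * hole_radius k) | w <- pow2_roots (pexp k) (- 1)].

Definition holes M : seq (C * R) := flatten [seq holes_at k | k <- iota 0 M].

Lemma two_pow_gt0 k : 0 < 2 ^+ m k :> R. Proof. exact: exprn_gt0. Qed.

Lemma hole_radius_ge0 k : 0 <= hole_radius k.
Proof. by rewrite /hole_radius !divr_ge0 // ltW // two_pow_gt0. Qed.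

Lemma two_powV_le k : (2 ^+ m k)^-1 <= (1 / 2) ^+ (k + 8) :> R.
Proof.
rewrite div1r exprVn lef_pV2 ?posrE ?exprn_gt0 //.
by apply: ler_weXn2l; [lra|exact: rexp_ge].
Qed.

Lemma two_powV_half k : (2 ^+ m k)^-1 <= 1 / 2 :> R.
Proof.
apply: le_trans (two_powV_le k) _; rewrite addnS exprS ler_piMr //; first by lra.
by rewrite exprn_ile1 //; lra.
Qed.

(** With d = 2 tau / n, Bernoulli's inequality gives
    (1 - d)^n <= 1 / (1 + d)^n <= 1 / (1 + 2 tau) <= 1 - tau, as required by
    [pow2_roots_near]. *)
Lemma outside_holes k z : modulus z <= 2 ->
  (forall h, h \in holes_at k -> h.2 < modulus (z - h.1)) ->
  (2 ^+ m k)^-1 <= modulus (g k z).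
Proof.
move=> z2 hz; rewrite leNgt; apply/negP => hg.
have r0 := radius_gt0 k; set n := (2 ^ pexp k)%N.
set tau := (2 ^+ m k)^-1 in hg.
have tau0 : 0 < tau by rewrite invr_gt0 two_pow_gt0.
have tau1 : tau <= 1 / 2 := two_powV_half k.
have n1 : 1 <= n%:R :> R by rewrite ler1n expn_gt0.
set d := hole_radius k.
have dE : d * n%:R = 2 * tau by rewrite /d /hole_radius divfK // lt0r_neq0 //; lra.
have d0 : 0 <= d := hole_radius_ge0 k.
have d1 : d <= 1 by nra.
have bern := bernoulli n d0.
have prod1 : (1 - d) ^+ n * (1 + d) ^+ n <= 1.
  by rewrite -exprMn exprn_ile1 //; nra.
have e0 : 0 <= (1 - d) ^+ n by rewrite exprn_ge0 //; lra.
have e1 : (1 - d) ^+ n <= 1 - tau.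
  have h1 : (1 - d) ^+ n * (1 + 2 * tau) <= 1.
    by apply: le_trans prod1; apply: ler_wpM2l => //; move: bern; rewrite mulrC dE.
  have h2 : 1 <= (1 - tau) * (1 + 2 * tau) by nra.
  rewrite leNgt; apply/negP => h3.
  have : (1 - tau) * (1 + 2 * tau) < (1 - d) ^+ n * (1 + 2 * tau) by rewrite ltr_pM2r //; lra.
  lra.
have [|||w wi hw] := @pow2_roots_near R (pexp k) (-1) ((z - center k) / ofreal (radius k)) d.
- by rewrite modulusN modulus1.
- by apply/andP.
- by rewrite opprK addrC -/(g k z) -/n; lra.
have := hz _ (map_f (fun w => (center k + ofreal (radius k) * w, radius k * hole_radius k)) wi).
rewrite /= -/d ltNge => /negP; apply.
have or0 : ofreal (radius k) != 0 by rewrite -modulus_gt0 modulus_ofreal normr_gt0 lt0r_neq0.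
have -> : z - (center k + ofreal (radius k) * w) =
   ofreal (radius k) * ((z - center k) / ofreal (radius k) - w) by field.
by rewrite modulusM modulus_ofreal gtr0_norm // ler_pM2l.
Qed.

Lemma holes_sum M : \sum_(h <- holes M) h.2 <= 1 / 64.
Proof.
rewrite /holes big_flatten /= big_map.
have hk k : \sum_(h <- holes_at k) h.2 <= (1 / 2) ^+ (k + 7).
  rewrite big_map /= big_const_seq count_predT iter_addr_0 size_pow2_roots.
  have dE : hole_radius k * (2 ^ pexp k)%:R = 2 / 2 ^+ m k.
    by rewrite /hole_radius divfK // pnatr_eq0 -lt0n expn_gt0.
  rewrite -[leLHS]mulr_natr -mulrA dE.
  have := two_powV_le k; have := radius_le1 k; have := ltW (radius_gt0 k).
  have : 0 < (2 ^+ m k)^-1 :> R by rewrite invr_gt0 two_pow_gt0.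
  rewrite addnS exprS; set tau := (2 ^+ m k)^-1; nra.
have -> : 1 / 64 = (1 / 2) ^+ 6 :> R by rewrite !exprS expr0; field.
suff : \sum_(k <- iota 0 M) \sum_(h <- holes_at k) h.2 <= (1 / 2) ^+ 6 - (1 / 2) ^+ (M + 6).
  by have : 0 <= (1 / 2) ^+ (M + 6) :> R; [rewrite exprn_ge0 //; lra|lra].
elim: M => [|M IH]; first by rewrite big_nil subrr.
rewrite -addn1 iotaD big_cat big_seq1 /= add0n.
have := hk M; rewrite addnS exprS addn1 addSn [(1 / 2) ^+ (M + 6).+1]exprS; lra.
Qed.

Lemma conj_isometry (x y : C) : modulus (x^* - y^*) = modulus (x - y).
Proof. by apply: ofreal_inj; rewrite -!modulusE -rmorphB norm_conjC. Qed.

(** A polynomial within 1 / 16 of the conjugate of z on X yields, after truncation of the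
    series for w and averaging over the roots, a rational function within 1 / 8 of it on
    the intersection of the cheeses, hence within 1 / 4 on one of them. *)
Lemma conj_not_approximable : ~ approximable X (fun x => (coord_z x)^*).
Proof.
move=> /(_ (1 / 16)) [|p hp]; first by lra.
have [K [K0 _ hK]] := @lipschitz_peval R 2 4 p.
have weight0 k : 0 < weight k := weight_gt0 _ _ _ radius_gt0 k.
(* N roots are kept: dropping the other terms of w changes the polynomial by at most 1 / 16 *)
have [N hN] : exists N, K * (4 * weight N) <= 1 / 16.
  have [||N hN] := @expr_small R (1 / 4) ((1 / 64) / (K + 1)); first by lra.
    by rewrite divr_gt0 //; lra.
  exists N; rewrite ltr_pdivlMr in hN; last by lra.
  have := weight_le center rexp pexp radius_gt0 N; have := weight0 N; nra.
have [G hG GE] := ratfun_average_all (leqnn N) (ratfun_peval N N p).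
pose G0 z := G z (fun=> 0).
have close z : (forall M, cheese M z) -> modulus (G0 z - z^*) <= 1 / 8.
  move=> hz.
  have g0 k : g k z != 0 by exact: cheese_pole_neq0 (hz k.+1) (ltnSn k).
  apply: GE => [k _|u hu]; first exact: g0.
  have /choice[v hv] : forall k, exists v, g k z * v ^+ m k = 1 by move=> k; exact: root_exists.
  pose u' k := if (k < N)%N then u k else v k.
  have gu' k : g k z * u' k ^+ m k = 1 by rewrite /u'; case: ltnP => // kN; exact: hu.
  have [w Xw hw] := surface_above hz gu'.
  have uu' : \sum_(i < N) ofreal (weight i) * u' i = \sum_(i < N) ofreal (weight i) * u i.
    by apply: eq_bigr => i _; rewrite /u' ltn_ord.
  have := hp _ Xw; rewrite coord_z_point => h1.
  have z2 : modulus z <= 2 by have [] := hz 0%N.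
  have u2 k : modulus (u' k) <= 2.
    by have [_ h] := hz k.+1; apply: root_le2 (h k (ltnSn k)) (gu' k).
  set S := \sum_(i < N) ofreal (weight i) * u i.
  have S4 : modulus S <= 4.
    have := partial_sum_cauchy u2 (leq0n N); rewrite big_ord0 subr0 uu' -/S.
    by rewrite [weight 0]/= mulr1.
  have w4 : modulus w <= 4.
    by have := hw 0%N; rewrite big_ord0 subr0 [weight 0]/= mulr1.
  have h2 : modulus (peval p (point z S) - peval p (point z w)) <= K * (4 * weight N).
    apply: hK.
    - by move=> i; rewrite mxE; case: ifP => _ //; lra.
    - by move=> i; rewrite mxE; case: ifP => _ //; lra.
    - by rewrite mulr_ge0 // ltW.
    - move=> i; rewrite !mxE; case: ifP => _; first by rewrite subrr modulus0 mulr_ge0 // ltW.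
      by rewrite modulusB; have := hw N; rewrite uu'.
  have := modulusBD (peval p (point z S)) (peval p (point z w)) z^*.
  rewrite (modulusB (peval p (point z w)) z^*); lra.
have tG M : (N <= M)%N -> tame (cheese M) G0.
  move=> NM; have [h1 [L [L0 a b]]] := ratfun_tame (fun=> 0) hG.
  have sub z : cheese M z -> cheese N z.
    by move=> [z2 h]; split=> // k kN; apply: h; exact: leq_trans kN NM.
  exists h1, L; split=> // [q /sub|q q' /sub hq /sub hq']; [exact: a|exact: b].
(* otherwise the sets where it fails are nested, closed and nonempty *)
have [M [NM hM]] : exists M, (N <= M)%N /\ forall z, cheese M z -> modulus (G0 z - z^*) <= 1 / 4.
  apply: contrapT => /forallNP hno.
  pose F n := [set z | cheese (n + N) z /\ 1 / 4 <= modulus (G0 z - z^*)].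
  have [||||z hz] := @nested_nonempty R F 2.
  - move=> n; have [h1 [L [L0 _ hL]]] := tG (n + N)%N (leq_addl n N).
    apply: (@closed_modulus_ge (cheese (n + N)) (fun z => G0 z - z^*) (L + 1)); last exact: cheese_closed.
      by rewrite addr_ge0.
    move=> z z' Ez Ez'; have [lip _] := hL z z' Ez Ez'.
    have -> : G0 z' - z'^* - (G0 z - z^*) = (G0 z' - G0 z) + (z^* - z'^*) by ring.
    rewrite mulrDl mul1r; apply: modulusD_le lip _.
    by rewrite conj_isometry modulusB.
  - move=> n q nq z [[z2 h] hd]; split=> //; split=> // k kn; apply: h.
    by apply: leq_trans kn _; rewrite leq_add2r.
  - move=> n; have := hno (n + N)%N; rewrite leq_addl => /not_andP[//|/existsNP[z]].
    by move=> /not_implyP[cz /negP]; rewrite -ltNge => hd; exists z; split=> //; exact: ltW.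
  - by move=> z [[z2 _] _].
  have all M : cheese M z.
    by have [[z2 h] _] := hz M; split=> // k kM; apply: h; rewrite ltn_addr.
  have := close z all; have [_] := hz 0%N; lra.
apply: (@conj_not_tame_approx R (cheese M) G0 (holes M)); first exact: tG.
- move=> h /flattenP[_ /mapP[k _ ->] /mapP[w _ ->]] /=.
  by rewrite mulr_ge0 ?hole_radius_ge0 // ltW.
- exact: holes_sum.
- move=> z re im hz.
  have z2 : modulus z <= 2.
    rewrite -(ler_pXn2r (n := 2)) ?nnegrE // modulus_sqr.
    move: re im => /andP[? ?] /andP[? ?]; nra.
  have cz : cheese M z.
    split=> // k kM; apply: outside_holes => // h hh; apply: hz.
    by apply/flattenP; exists (holes_at k) => //; apply/mapP; exists k; rewrite ?mem_iota.
  by split=> //; exact: hM.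
Qed.

End NonDensity.

(** * A family of discs shrinking to every point *)

Section Discs.
Variable R : realType.
Local Notation C := (cplx R).

(** Codes (t, (a, b)) for discs of radius 4 / (t + 4) centred at the points
    (a + i b) / (t + 4) - 2 - 2 i of a lattice; every point of the disc |z| <= 2 is within
    half the radius of a centre. *)
Definition disc_code (k : nat) : nat * (nat * nat) := odflt (0, (0, 0))%N (unpickle k).

Definition disc_radius (k : nat) : R := 4 / ((disc_code k).1 + 4)%:R.

Definition disc_center (k : nat) : C :=
  let: (t, (a, b)) := disc_code k in
  ofreal (a%:R / (t + 4)%:R - 2) + 'i * ofreal (b%:R / (t + 4)%:R - 2).

(** The root of order 2^(k + 8) makes the k-th holes small enough for the sum of all radii
    to be at most 1 / 64; the exponent of g_k is then chosen so large that
    (k + 1)^m <= 2^n - 1. *)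
Definition root_exp (k : nat) : nat := (k + 8)%N.
Definition pole_exp (k : nat) : nat := (2 ^ root_exp k * k).+1.

Lemma disc_radius_gt0 k : 0 < disc_radius k.
Proof. by rewrite divr_gt0 // ltr0n addnS. Qed.

Lemma disc_radius_le1 k : disc_radius k <= 1.
Proof. by rewrite ler_pdivrMr ?ltr0n ?addnS // mul1r ler_nat !ltnS. Qed.

Lemma root_exp_ge k : (k + 8 <= 2 ^ root_exp k)%N.
Proof. exact/ltnW/ltn_expl. Qed.

Lemma disc_cover (z : C) (e : R) (N : nat) : modulus z <= 2 -> 0 < e ->
  exists k, [/\ (N <= k)%N, modulus (z - disc_center k) <= disc_radius k / 2 &
                5 / 2 * disc_radius k <= e].
Proof.
move=> z2 e0.
(* a code beyond those of index below N *)
set T := (\sum_(k < N) (disc_code k).1)%N.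
have [q hq] : exists q : nat, 10 / e < q.+1%:R by exists (Num.truncn (10 / e)); exact: truncnS_gt.
set t := (T.+1 + q)%N.
have t0 : 0 < (t + 4)%:R :> R by rewrite ltr0n addnS.
have coord (x : R) : `|x| <= 2 -> exists a : nat, `|x - (a%:R / (t + 4)%:R - 2)| <= 1 / (t + 4)%:R.
  rewrite ler_norml => /andP[x1 x2].
  have p0 : 0 <= (x + 2) * (t + 4)%:R by rewrite mulr_ge0 //; lra.
  have /andP[a1 a2] := truncn_itv p0; set a := Num.truncn _ in a1 a2.
  have a3 : a.+1%:R = a%:R + 1 :> R by rewrite natr1.
  exists a; set D := (t + 4)%:R in t0 a1 a2 *.
  have -> : x - (a%:R / D - 2) = ((x + 2) * D - a%:R) / D.
    by rewrite mulrBl mulfK ?lt0r_neq0 //; ring.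
  rewrite normrM normfV (gtr0_norm t0) ler_pM2r ?invr_gt0 // ler_norml; lra.
have [a ha] := coord _ (le_trans (modulus_Re z) z2).
have [b hb] := coord _ (le_trans (modulus_Im z) z2).
exists (pickle (t, (a, b))).
have code : disc_code (pickle (t, (a, b))) = (t, (a, b)) by rewrite /disc_code pickleK.
split.
- rewrite leqNgt; apply/negP => kN.
  have : ((disc_code (Ordinal kN)).1 <= T)%N by rewrite /T (bigD1 (Ordinal kN)) //= leq_addr.
  by rewrite /= code /= /t; lia.
- rewrite /disc_center /disc_radius code /=.
  rewrite [z in z - _]ofreal_ReIm.
  have -> r s r' s' : ofreal r + 'i * ofreal s - (ofreal r' + 'i * ofreal s') =
      ofreal (r - r') + 'i * ofreal (s - s') :> C by rewrite !ofrealB; ring.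
  apply: le_trans (modulusD _ _) _.
  rewrite modulusM modulus_i mul1r !modulus_ofreal.
  apply: le_trans (lerD ha hb) _; lra.
- rewrite /disc_radius code /=.
  have h1 : 10 / e < (t + 4)%:R.
    by apply: lt_le_trans hq _; rewrite ler_nat /t; lia.
  have h2 : 10 / (t + 4)%:R <= e by rewrite ler_pdivrMr // mulrC -ler_pdivrMr // ltW.
  by lra.
Qed.

Lemma disc_pole_near k (z : C) : modulus (z - disc_center k) <= disc_radius k / 2 ->
  modulus (pole_poly disc_center disc_radius pole_exp k z) <= 3 / 2.
Proof.
move=> h; have r0 := disc_radius_gt0 k; apply: le_trans (modulusD _ _) _.
rewrite modulus1 modulusX.
set t := modulus _.
have t0 : 0 <= t := modulus_ge0 _.
have t1 : t <= 1 / 2.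
  by rewrite /t modulusM modulusV modulus_ofreal gtr0_norm // ler_pdivrMr //; lra.
have : t ^+ (2 ^ pole_exp k) <= t.
  have n0 : (0 < 2 ^ pole_exp k)%N by rewrite expn_gt0.
  by rewrite -(prednK n0) exprS ler_piMr // exprn_ile1 //; lra.
lra.
Qed.

Lemma disc_pole_far k (z : C) : 2 * disc_radius k <= modulus (z - disc_center k) ->
  k.+1%:R ^+ (2 ^ root_exp k) <= modulus (pole_poly disc_center disc_radius pole_exp k z).
Proof.
move=> h; have r0 := disc_radius_gt0 k.
rewrite /pole_poly; set t := (_ / _ : C); set n := (2 ^ pole_exp k)%N.
have t2 : 2 <= modulus t.
  by rewrite /t modulusM modulusV modulus_ofreal gtr0_norm // ler_pdivlMr.
have : 2 ^+ n <= modulus (t ^+ n) by rewrite modulusX lerXn2r ?nnegrE //; lra.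
have := modulus_ler (t ^+ n) (- 1); rewrite modulusN modulus1 opprK [t ^+ n + 1]addrC.
suff : k.+1%:R ^+ (2 ^ root_exp k) + 1 <= 2 ^+ n :> R by lra.
set m := (2 ^ root_exp k)%N.
have h1 : (k.+1 ^ m <= 2 ^ (m * k))%N.
  by rewrite mulnC expnM leq_exp2r ?expn_gt0 // ltn_expl.
have h2 : (2 ^ (m * k).+1 <= 2 ^ n)%N by rewrite leq_exp2l // ltnW // ltn_expl.
rewrite -!natrX natr1 ler_nat.
by move: h1 h2; rewrite expnS; have := expn_gt0 2 (m * k); lia.
Qed.

End Discs.

Lemma conj_coord_continuous (R : realType) :
  continuous ((fun x => (coord_z x)^*) : 'rV[cplx R]_2 -> cplx R).
Proof.
move=> x; apply: (iffRL (modulus_cvgP _ _ (nbhs_filter x))) => e e0.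
have cz : coord_z t @[t --> x] --> coord_z x := @coordinate_continuous R 2 ord0 x.
apply: filterS (iffLR (modulus_cvgP _ _ (nbhs_filter x)) cz e e0) => t.
by rewrite conj_isometry.
Qed.

Theorem theorem1p2 (R : realType) :
  exists X : set 'rV[cplx R]_2,
    [/\ compact X, poly_convex X, PX X <> CX X &
        forall x : 'rV[cplx R]_2, X x -> peak_point X (PX X) x].
Proof.
exists (surface (@disc_center R) (@disc_radius R) root_exp pole_exp); split.
- exact: surface_compact (@disc_radius_gt0 R).
- exact: surface_poly_convex (@disc_radius_gt0 R).
- move=> PC; apply: (@conj_not_approximable R (@disc_center R) (@disc_radius R) root_exp pole_exp
    (@disc_radius_gt0 R) (@disc_radius_le1 R) root_exp_ge).
  apply/PX_approximable; rewrite PC /CX /=.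
  have := @continuous_subspaceT _ _ (surface (@disc_center R) (@disc_radius R) root_exp pole_exp)
    _ (@conj_coord_continuous R).
  exact.
- apply: surface_peak_point; first exact: disc_radius_gt0.
  + exact: disc_cover.
  + exact: disc_pole_near.
  + exact: disc_pole_far.
Qed.
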